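(* Let $A\in\mathbb{R}^{n\times n}$ be symmetric with eigenvalues $\lambda_1>\lambda_2\ge\cdots\ge\lambda_n$ and $\lambda_1>0$, and assume that the positive eigenvalues of $A$ are distinct. Let $f(x)=\|A-xx^\top\|_F^2$. Let $R\ge\sqrt{\max_j\|A_{:,j}\|}$ be a constant, let the stepsize $\gamma>0$ satisfy $\gamma\le\frac{1}{4(n+4)R^2}$, and let $W_0=\{x\in\mathbb{R}^n:\|x\|_\infty<R\}$. Given $x^{(0)}\in W_0$, let $(x^{(\ell)})_{\ell\ge0}$ be the CD-Cyc-Grad iteration with stepsize $\gamma$ started from $x^{(0)}$. Then for all $x^{(0)}\in W_0$ outside a set of Lebesgue measure zero, $x^{(\ell)}$ converges, as $\ell\to\infty$, to a global minimizer of $f$.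
   Context: $\|\cdot\|_F$ is the Frobenius norm, $\|\cdot\|$ the Euclidean norm of a vector, and $A_{:,j}$ the $j$-th column of $A$. The CD-Cyc-Grad iteration (cyclic coordinate-wise gradient descent for $f$) is: at step $\ell\ge 0$ set $j_\ell=(\ell \bmod n)+1$, and define $$x^{(\ell+1)}_{j}=\begin{cases}x^{(\ell)}_{j}-\gamma\left(-4(Ax^{(\ell)})_{j}+4\|x^{(\ell)}\|^2x^{(\ell)}_{j}\right), & j=j_\ell,\\ x^{(\ell)}_j, & j\ne j_\ell.\end{cases}$$ Here $-4(Ax)_j+4\|x\|^2x_j$ is the $j$-th entry of $\nabla f(x)$. *)

(* Defs.v *)
From HB Require Import structures.
From mathcomp Require Import all_boot all_order all_algebra.
From mathcomp Require Import all_classical all_reals all_analysis.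

Set Implicit Arguments.
Unset Strict Implicit.
Unset Printing Implicit Defensive.

Import Order.TTheory GRing.Theory Num.Theory.
Import numFieldNormedType.Exports.

Local Open Scope classical_set_scope.
Local Open Scope ring_scope.

Section Norms.
Variable R : realType.

Definition frobenius_norm m n (A : 'M[R]_(m, n)) : R :=
  Num.sqrt (\sum_(i < m) \sum_(j < n) A i j ^+ 2).

(* The library's norm [`|x|] on matrices is the largest absolute value of an
   entry, so that the Euclidean norm has to be defined separately. *)
Definition euclidean_norm n (x : 'cV[R]_n) : R :=
  Num.sqrt (\sum_(i < n) x i 0 ^+ 2).

End Norms.

Section LebesgueOuterMeasure.
Variables (R : realType) (n : nat).
Implicit Types (a b : 'cV[R]_n) (X : set 'cV[R]_n).

Definition box a b : set 'cV[R]_n :=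
  [set x | forall i, a i 0 < x i 0 <= b i 0].

Definition box_volume a b : R := \prod_(i < n) (b i 0 - a i 0).

(* The library has Lebesgue measure on R only. As there, n-dimensional Lebesgue
   measure is the restriction to the measurable sets of the outer measure
   obtained from countable covers by half-open boxes. A set is measurable and
   of measure zero exactly when its outer measure is zero. *)
Definition lebesgue_outer_measure X : \bar R :=
  ereal_inf [set v : \bar R | exists a b : nat -> 'cV[R]_n,
    [/\ forall k i, a k i 0 <= b k i 0,
        X `<=` \bigcup_k box (a k) (b k)
      & v = (\sum_(0 <= k <oo) (box_volume (a k) (b k))%:E)%E]].

Definition lebesgue_null X : Prop := lebesgue_outer_measure X = 0%E.

End LebesgueOuterMeasure.

Section CoordinateDescent.
Variable R : realType.

Definition objective n (A : 'M[R]_n) (x : 'cV[R]_n) : R :=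
  frobenius_norm (A - x *m x^T) ^+ 2.

Definition global_minimizer (T : Type) (f : T -> R) (x : T) : Prop :=
  forall y, f x <= f y.

(* j-th entry of the gradient of [objective A] at x, for symmetric A *)
Definition objective_grad n (A : 'M[R]_n) (x : 'cV[R]_n) (j : 'I_n) : R :=
  - 4 * (A *m x) j 0 + 4 * euclidean_norm x ^+ 2 * x j 0.

Definition cd_step n (A : 'M[R]_n) (gamma : R) (jl : 'I_n) (x : 'cV[R]_n) :
    'cV[R]_n :=
  \col_j (if j == jl then x j 0 - gamma * objective_grad A x j else x j 0).

(* Coordinates are numbered from 0, so step l updates coordinate l mod n.+1 in
   dimension n.+1. *)
Fixpoint cd_cyc_grad n (A : 'M[R]_n.+1) (gamma : R) (x0 : 'cV[R]_n.+1)
    (l : nat) : 'cV[R]_n.+1 :=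
  if l is l'.+1
  then cd_step A gamma (inord (l' %% n.+1)) (cd_cyc_grad A gamma x0 l')
  else x0.

End CoordinateDescent.

(* Main.v *)
Require Import Defs.
From mathcomp Require Import all_boot all_order all_algebra.
From mathcomp Require Import all_classical all_reals all_analysis.
From mathcomp Require Import ring lra.
Import Order.TTheory GRing.Theory Num.Theory.
Import numFieldNormedType.Exports.
Local Open Scope classical_set_scope.
Local Open Scope ring_scope.
Set Implicit Arguments.
Unset Strict Implicit.
Unset Printing Implicit Defensive.

(** Write N = n.+1 for the dimension, f for the objective and W for the open
    sup-norm ball of radius rho. The argument has three parts.

    Convergence. The stepsize keeps the iterates in W ([cd_step_stays]), and
    each step decreases f by at least gamma / 2 times the square of the partial
    derivative that it uses ([cd_step_descent]). As f is bounded below, these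
    derivatives tend to 0; so do the steps, hence the whole gradient
    ([grad_small]). The nonzero critical points are the eigenvectors x with
    A x = |x|^2 x. A positive eigenvalue is simple, so each carries at most two
    of them and there are finitely many critical points ([critical_finite]). A
    bounded sequence with vanishing steps and vanishing gradient then converges
    to one of them ([orbit_cvg_critical]).

    Which critical points are minimizers. At a critical point f equals
    |A|_F^2 - |x|^4, so f is least at those with |x|^2 equal to the top
    eigenvalue. That these minimize f globally follows from the convergence
    part: descent from any competitor, in a larger ball and with a smaller
    step, ends at a critical point whose value is no larger
    ([top_critical_global_minimizer]). At every other critical point the top
    eigenvector is a direction of negative curvature
    ([nonminimal_critical_strict_saddle]).

    Saddles attract only a null set. The quadratic form q of the Hessian H at
    the saddle z does the work of a stable manifold theorem. Let v be
    the difference of two orbits that stay close to z. A step is exact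
    coordinate descent for q up to a small relative error, so a cycle of N
    steps lowers q(v) by about c |H v|^2 ([cycle_decrease]). After replacing H
    by H + e with a small e, also to cover singular H, a negative value of q is
    multiplied by a factor 1 + eta or more in every cycle
    ([negative_cone_expansion]). Two orbits that never leave a neighbourhood of
    z cannot diverge in this way, so the differences of points of the local
    stable set avoid the cone q < 0. Such a set is a Lipschitz graph over a
    hyperplane, hence null ([avoids_cone_content_null]). A step is injective on
    W with Lipschitz inverse ([cd_step_expansive]), so the points of W that
    reach the local stable set after k cycles form a null set for every k, and
    the union over k and over the saddles is the exceptional set. *)

(** * Sup norm, dot product and their comparison *)

Section SupNormAndDotProduct.
Variables (R : realType) (n : nat).
Implicit Types (x y z : 'cV[R]_n.+1) (H : 'M[R]_n.+1).

Lemma sup_norm_le x (r : R) :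
  0 <= r -> (forall i, `|x i 0| <= r) <-> `|x| <= r.
Proof.
move=> r0; rewrite /Num.norm /= mx_normrE; split=> [xr|xr i].
  by apply/bigmax_leP; split=> // -[i j] _ /=; rewrite (ord1 j); exact: xr.
by move/bigmax_leP: xr => [_ /(_ (i, 0) isT)].
Qed.

Lemma sup_norm_lt x (r : R) :
  0 < r -> (forall i, `|x i 0| < r) <-> `|x| < r.
Proof.
move=> r0; rewrite /Num.norm /= mx_normrE; split=> [xr|xr i].
  by apply/bigmax_ltP; split=> // -[i j] _ /=; rewrite (ord1 j); exact: xr.
by move/bigmax_ltP: xr => [_ /(_ (i, 0) isT)].
Qed.

Lemma entry_le_norm x i : `|x i 0| <= `|x|.
Proof. by move: i; apply/sup_norm_le. Qed.

Definition dotp x y : R := \sum_i x i 0 * y i 0.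

Lemma dotp_mx x y : dotp x y = (x^T *m y) 0 0.
Proof. by rewrite mxE; apply: eq_bigr => i _; rewrite mxE. Qed.

Lemma dotpC x y : dotp x y = dotp y x.
Proof. by apply: eq_bigr => i _; rewrite mulrC. Qed.

Lemma dotpDl x y z : dotp (x + y) z = dotp x z + dotp y z.
Proof. by rewrite !dotp_mx linearD mulmxDl mxE. Qed.

Lemma dotpDr x y z : dotp z (x + y) = dotp z x + dotp z y.
Proof. by rewrite dotpC dotpDl !(dotpC z). Qed.

Lemma dotpZl a x y : dotp (a *: x) y = a * dotp x y.
Proof. by rewrite !dotp_mx linearZ -scalemxAl mxE. Qed.

Lemma dotpZr a x y : dotp x (a *: y) = a * dotp x y.
Proof. by rewrite dotpC dotpZl dotpC. Qed.

Lemma dotp_delta x i : dotp x (delta_mx i 0) = x i 0.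
Proof.
rewrite /dotp (bigD1 i) //= big1 => [|j ji]; rewrite mxE ?eqxx ?mulr1 ?addr0//.
by rewrite (negPf ji) mulr0.
Qed.

Lemma dotp_ge0 x : 0 <= dotp x x.
Proof. by apply: sumr_ge0 => i _; rewrite -expr2 sqr_ge0. Qed.

Lemma dotp_eq0 x : dotp x x = 0 -> x = 0.
Proof.
move=> /eqP; rewrite psumr_eq0 => [/allP x0|i _]; last by rewrite -expr2 sqr_ge0.
apply/matrixP => i j; rewrite ord1 mxE.
by have := x0 i (mem_index_enum _); rewrite mulf_eq0 orbb => /eqP.
Qed.

Lemma dotp_gt0 x : x != 0 -> 0 < dotp x x.
Proof.
move=> x0; rewrite lt_neqAle dotp_ge0 andbT eq_sym.
by apply: contra_neq x0 => /dotp_eq0.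
Qed.

Lemma dotp_norm x y : `|dotp x y| <= n.+1%:R * (`|x| * `|y|).
Proof.
apply: le_trans (ler_norm_sum _ _ _) _.
apply: (@le_trans _ _ (\sum_(i < n.+1) `|x| * `|y|)).
  by apply: ler_sum => i _; rewrite normrM ler_pM ?entry_le_norm.
by rewrite sumr_const card_ord mulr_natl.
Qed.

Lemma norm_sqr_le_dotp x : `|x| ^+ 2 <= dotp x x.
Proof.
rewrite -[leRHS]sqr_sqrtr ?dotp_ge0// ler_pXn2r ?nnegrE ?sqrtr_ge0//.
apply/sup_norm_le => [|i]; rewrite ?sqrtr_ge0//.
rewrite -sqrtr_sqr ler_wsqrtr// expr2 /dotp (bigD1 i)//= lerDl.
by apply: sumr_ge0 => j _; rewrite -expr2 sqr_ge0.
Qed.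

Lemma dotp_cauchy_schwarz x y : dotp x y ^+ 2 <= dotp x x * dotp y y.
Proof.
have [->|/dotp_gt0 y0] := eqVneq y 0.
  have d0 z : dotp z 0 = 0 by rewrite -(scale0r z) dotpZr mul0r.
  by rewrite !d0 mulr0 expr0n.
have := dotp_ge0 (dotp y y *: x + (- dotp x y) *: y).
rewrite !(dotpDl, dotpDr, dotpZl, dotpZr) (dotpC y x).
set a := dotp x x; set b := dotp x y; set c := dotp y y in y0 * => H.
rewrite -subr_ge0 -(pmulr_rge0 _ y0); apply: le_trans H _.
by rewrite le_eqVlt; apply/orP; left; apply/eqP; ring.
Qed.

Lemma dotp_mulmxl H x y : H^T = H -> dotp (H *m x) y = dotp x (H *m y).
Proof. by move=> HT; rewrite !dotp_mx trmx_mul HT mulmxA. Qed.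

Lemma mulmx_entry H x j : (H *m x) j 0 = \sum_k H j k * x k 0.
Proof. by rewrite mxE. Qed.

Lemma mulmx_norm H (M : R) x :
  (forall i j, `|H i j| <= M) -> `|H *m x| <= n.+1%:R * M * `|x|.
Proof.
move=> HM; have M0 : 0 <= M by apply: le_trans (HM ord0 ord0).
apply/sup_norm_le => [|i]; first by rewrite !mulr_ge0.
rewrite mulmx_entry; apply: le_trans (ler_norm_sum _ _ _) _.
apply: (@le_trans _ _ (\sum_(k < n.+1) M * `|x|)).
  by apply: ler_sum => k _; rewrite normrM ler_pM ?entry_le_norm.
by rewrite sumr_const card_ord -mulrA mulr_natl.
Qed.

Lemma euclidean_norm_sqr x : euclidean_norm x ^+ 2 = dotp x x.
Proof.
rewrite /euclidean_norm sqr_sqrtr; first by apply: eq_bigr => i _; rewrite expr2.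
by apply: sumr_ge0 => i _; rewrite sqr_ge0.
Qed.

End SupNormAndDotProduct.

(** * One coordinate step *)

Section CoordinateStep.
Variables (R : realType) (n : nat) (A : 'M[R]_n.+1) (rho gamma : R).
Hypothesis A_sym : A^T = A.
Hypothesis rho_gt0 : 0 < rho.
Hypothesis col_le : forall j, dotp (col j A) (col j A) <= rho ^+ 4.
Hypothesis gamma_gt0 : 0 < gamma.
Hypothesis gamma_le : gamma * (4 * (n.+1%:R + 4) * rho ^+ 2) <= 1.
Implicit Types (x y z : 'cV[R]_n.+1).

Local Notation N := (n.+1%:R : R).
Local Notation grad := (objective_grad A).
Local Notation step := (cd_step A gamma).
Local Notation e_ j := (delta_mx j 0 : 'cV[R]_n.+1).

Let N_ge1 : 1 <= N. Proof. by rewrite ler1n. Qed.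

Let gamma_rho_gt0 : 0 < gamma * rho ^+ 2.
Proof. by rewrite mulr_gt0// exprn_gt0. Qed.

Let gamma_rho_leN : gamma * rho ^+ 2 <= gamma * rho ^+ 2 * N.
Proof. by rewrite ler_peMr// ltW. Qed.

Lemma objective_gradE x j : grad x j = - 4 * (A *m x) j 0 + 4 * dotp x x * x j 0.
Proof. by rewrite /objective_grad euclidean_norm_sqr. Qed.

Lemma cd_stepE j x : step j x = x + (- (gamma * grad x j)) *: e_ j.
Proof.
apply/matrixP => i k; rewrite ord1 !mxE /=; case: eqP => [->|_] /=.
  by rewrite mulr1.
by rewrite mulr0 addr0.
Qed.

Lemma objectiveE x : objective A x =
  \sum_i \sum_j A i j ^+ 2 - 2 * dotp x (A *m x) + dotp x x ^+ 2.
Proof.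
rewrite /objective /frobenius_norm sqr_sqrtr; last first.
  by do 2![apply: sumr_ge0 => ? _]; rewrite sqr_ge0.
have -> : dotp x (A *m x) = \sum_i \sum_j A i j * (x i 0 * x j 0).
  apply: eq_bigr => i _; rewrite mulmx_entry mulr_sumr.
  by apply: eq_bigr => j _; rewrite mulrCA.
have -> : dotp x x ^+ 2 = \sum_i \sum_j (x i 0 * x j 0) ^+ 2.
  rewrite expr2 {1}/dotp mulr_suml; apply: eq_bigr => i _.
  by rewrite mulr_sumr; apply: eq_bigr => j _; ring.
rewrite mulr_sumr -sumrB -big_split /=; apply: eq_bigr => i _.
rewrite mulr_sumr -sumrB -big_split /=; apply: eq_bigr => j _.
have -> : (A - x *m x^T) i j = A i j - x i 0 * x j 0.
  by rewrite !mxE big_ord1 !mxE.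
ring.
Qed.

Lemma mulmx_col x j : (A *m x) j 0 = dotp (col j A) x.
Proof. by rewrite mulmx_entry; apply: eq_bigr => k _; rewrite mxE -{1}A_sym mxE. Qed.

Lemma entry_le_sqr i j : `|A i j| <= rho ^+ 2.
Proof.
rewrite -ler_sqr ?nnegrE ?exprn_ge0 ?(ltW rho_gt0)// -exprM real_normK ?num_real//.
apply: le_trans (col_le j); rewrite /dotp (bigD1 i)//= mxE -expr2 lerDl.
by apply: sumr_ge0 => k _; rewrite -expr2 sqr_ge0.
Qed.

Lemma dotp_le_rho x : `|x| <= rho -> dotp x x <= N * rho ^+ 2.
Proof.
move=> xr; apply: le_trans (ler_norm _) _; apply: le_trans (dotp_norm _ _) _.
by rewrite ler_wpM2l// expr2 ler_pM.
Qed.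

(** Invariance of the ball, read on one coordinate: [a] is the coordinate, [s]
    the Euclidean norm of the point and [b] the coordinate of its image by A.
    The new value is a convex combination of a and b / s^2, with weight
    4 gamma s^2 on the latter. For s < rho the bound |a| <= s is the useful one,
    for s >= rho the bound |a| < rho is. *)
Let step_scalar (a b s : R) : 0 <= s -> `|a| <= s -> `|a| < rho ->
  s ^+ 2 <= N * rho ^+ 2 -> `|b| <= rho ^+ 2 * s ->
  `|a - gamma * (- 4 * b + 4 * s ^+ 2 * a)| < rho.
Proof.
move=> s0 as_ ar sN bs.
have r2 : 0 < rho ^+ 2 by rewrite exprn_gt0.
have gr : gamma * rho ^+ 2 <= 1 / 20.
  by have := gamma_le; have := gamma_rho_gt0; have := gamma_rho_leN; lra.
have k0 : 0 <= 1 - 4 * gamma * s ^+ 2.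
  have := gamma_le; have : gamma * s ^+ 2 <= gamma * (N * rho ^+ 2).
    by rewrite ler_wpM2l// ltW.
  by have := gamma_rho_gt0; lra.
have -> : a - gamma * (- 4 * b + 4 * s ^+ 2 * a) =
  a * (1 - 4 * gamma * s ^+ 2) + 4 * gamma * b by ring.
apply: le_lt_trans (ler_normD _ _) _; rewrite !normrM (ger0_norm k0).
rewrite (ger0_norm (ltW gamma_gt0)) (ger0_norm (ler0n _ 4)).
have H1 : 4 * gamma * `|b| <= 4 * gamma * (rho ^+ 2 * s).
  by rewrite ler_wpM2l// mulr_ge0// ltW.
apply: le_lt_trans (lerD (lexx _) H1) _.
have [sr|rs] := ltP s rho.
  have H2 : `|a| * (1 - 4 * gamma * s ^+ 2) <= s * (1 - 4 * gamma * s ^+ 2).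
    by rewrite ler_wpM2r.
  apply: le_lt_trans (lerD H2 (lexx _)) _.
  have H3 : gamma * (s * (rho + s)) <= 2 * (gamma * rho ^+ 2).
    rewrite [leRHS]mulrCA ler_pM2l// [2 * _]mulr_natl mulr2n expr2 -mulrDr.
    by apply: ler_pM => //; lra.
  rewrite -subr_gt0.
  have -> : rho - (s * (1 - 4 * gamma * s ^+ 2) + 4 * gamma * (rho ^+ 2 * s)) =
    (rho - s) * (1 - 4 * (gamma * (s * (rho + s)))) by ring.
  by rewrite mulr_gt0 ?subr_gt0//; lra.
have [k1|k1] := leP (1 - 4 * gamma * s ^+ 2) 0.
  have -> : 1 - 4 * gamma * s ^+ 2 = 0 by apply/le_anti; rewrite k1 k0.
  have sg : 4 * gamma * s ^+ 2 = 1 by lra.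
  have : gamma * s ^+ 2 <= gamma * (N * rho ^+ 2) by rewrite ler_wpM2l// ltW.
  by have := gamma_le; have := gamma_rho_gt0; lra.
have H2 : `|a| * (1 - 4 * gamma * s ^+ 2) < rho * (1 - 4 * gamma * s ^+ 2).
  by rewrite ltr_pM2r.
apply: lt_le_trans (ltr_leD H2 (lexx _)) _.
rewrite -subr_ge0.
have -> : rho - (rho * (1 - 4 * gamma * s ^+ 2) + 4 * gamma * (rho ^+ 2 * s)) =
    4 * gamma * (rho * (s * (s - rho))) by ring.
by rewrite !mulr_ge0 ?subr_ge0// ltW.
Qed.

Lemma cd_step_stays x j : `|x| < rho -> `|step j x| < rho.
Proof.
move=> xr; apply/(sup_norm_lt _ rho_gt0) => i; rewrite mxE.
have xi : `|x i 0| < rho by move: i; apply/sup_norm_lt.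
case: eqP => [->|//]; rewrite objective_gradE.
have xj : `|x j 0| < rho by move: j; apply/sup_norm_lt.
have s2 : Num.sqrt (dotp x x) ^+ 2 = dotp x x by rewrite sqr_sqrtr ?dotp_ge0.
rewrite -s2; apply: step_scalar => //.
- apply: le_trans (entry_le_norm _ _) _.
  by rewrite -ler_sqr ?nnegrE ?sqrtr_ge0// s2 norm_sqr_le_dotp.
- by rewrite s2 dotp_le_rho// ltW.
rewrite -ler_sqr ?nnegrE ?mulr_ge0 ?sqrtr_ge0 ?exprn_ge0 ?(ltW rho_gt0)//.
rewrite real_normK ?num_real// exprMn s2 -exprM mulmx_col.
by apply: le_trans (dotp_cauchy_schwarz _ _) _; rewrite ler_wpM2r ?dotp_ge0.
Qed.

(** The objective is a quartic polynomial on each coordinate line. Keeping the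
    cubic and quartic terms inside the square [2 x_j + t] leaves a coefficient of
    t^2 that is bounded as soon as both ends of the segment lie in the ball. *)
Lemma objective_line x j t : objective A (x + t *: e_ j) - objective A x =
  t * grad x j + t ^+ 2 * (- 2 * A j j + 2 * dotp x x + (2 * x j 0 + t) ^+ 2).
Proof.
have Ae : (A *m e_ j) j 0 = A j j by rewrite -colE mxE.
have ee : e_ j j 0 = 1 by rewrite mxE !eqxx.
rewrite !objectiveE objective_gradE mulmxDr -scalemxAr.
rewrite !(dotpDl, dotpDr, dotpZl, dotpZr).
rewrite -(dotp_mulmxl x (e_ j) A_sym) !(dotpC (e_ j)) !dotp_delta Ae ee.
ring.
Qed.

Lemma cd_step_descent x j : `|x| < rho ->
  objective A (step j x) <= objective A x - gamma / 2 * grad x j ^+ 2.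
Proof.
move=> xr; have yr := cd_step_stays j xr.
rewrite -lerBlDl.
have := objective_line x j (- (gamma * grad x j)); rewrite -cd_stepE => ->.
set g := grad x j.
have yj : (step j x) j 0 = x j 0 - gamma * g by rewrite mxE eqxx.
have := entry_le_norm (step j x) j; have := entry_le_norm x j.
rewrite yj => xj {}yj; have := entry_le_sqr j j => Aj.
have {}xr := ltW xr; have {}yr := ltW yr.
have d2 := dotp_le_rho xr.
have s2 : (2 * x j 0 + - (gamma * g)) ^+ 2 <= 4 * rho ^+ 2.
  have -> : 4 * rho ^+ 2 = (2 * rho) ^+ 2 by ring.
  rewrite -[leLHS]real_normK ?num_real// ler_sqr ?nnegrE//; last by rewrite mulr_ge0// ltW.
  have -> : 2 * x j 0 + - (gamma * g) = x j 0 + (x j 0 - gamma * g) by ring.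
  apply: le_trans (ler_normD _ _) _; lra.
have Aj' : - A j j <= rho ^+ 2 by move: Aj; rewrite ler_norml; lra.
set K := (- 2 * A j j + _ + _).
have KN : gamma * K <= 2^-1.
  have : gamma * K <= gamma * (2 * (N + 4) * rho ^+ 2).
    by rewrite ler_pM2l// /K; have := exprn_gt0 2 rho_gt0; lra.
  by have := gamma_le; lra.
have -> : - (gamma * g) * g + (- (gamma * g)) ^+ 2 * K =
  - (gamma * g ^+ 2 * (1 - gamma * K)) by ring.
have p0 : 0 <= gamma * g ^+ 2 by rewrite mulr_ge0 ?sqr_ge0 ?ltW.
have k1 : 2^-1 <= 1 - gamma * K by lra.
by have := ler_wpM2l p0 k1; lra.
Qed.

Lemma grad_sub x y j : grad x j - grad y j =
  - 4 * (A *m (x - y)) j 0 +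
  4 * (dotp x x * (x - y) j 0 + dotp (x + y) (x - y) * y j 0).
Proof.
rewrite !objective_gradE mulmxBr.
rewrite -[x - y]/(x + - y) -(scaleN1r y) !(dotpDl, dotpDr, dotpZl, dotpZr).
by rewrite (dotpC y x) !mxE; ring.
Qed.

(** The constant 16 N rho^2 is not sharp; its product with gamma is at most 4,
    which is what [cd_step_expansive] uses. *)
Lemma grad_lipschitz x y j : `|x| <= rho -> `|y| <= rho ->
  `|grad x j - grad y j| <= 16 * N * rho ^+ 2 * `|x - y|.
Proof.
move=> xr yr; rewrite grad_sub; set v := x - y.
apply: le_trans (ler_normD _ _) _; rewrite !normrM normrN !(ger0_norm (ler0n _ 4)).
have H1 : `|(A *m v) j 0| <= N * rho ^+ 2 * `|v|.
  exact: le_trans (entry_le_norm _ _) (mulmx_norm _ entry_le_sqr).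
have H2 : `|dotp x x * v j 0| <= N * rho ^+ 2 * `|v|.
  rewrite normrM ler_pM ?entry_le_norm// ger0_norm ?dotp_ge0//.
  exact: dotp_le_rho.
have H3 : `|dotp (x + y) v * y j 0| <= 2 * N * rho ^+ 2 * `|v|.
  have -> : 2 * N * rho ^+ 2 * `|v| = N * ((rho + rho) * `|v|) * rho by ring.
  rewrite normrM ler_pM ?(le_trans (entry_le_norm _ _) yr)//.
  apply: le_trans (dotp_norm _ _) _; rewrite ler_wpM2l// ler_wpM2r//.
  by apply: le_trans (ler_normD _ _) _; rewrite lerD.
have := ler_normD (dotp x x * v j 0) (dotp (x + y) v * y j 0).
lra.
Qed.

(** A step is injective on the ball with Lipschitz inverse. It moves only
    coordinate j, and along that coordinate its derivative is at least
    1 - (N + 3) / (N + 4) by the choice of gamma; the other coordinates of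
    x - y are those of the images. The auxiliary point z, equal to y except that
    its coordinate j is that of x, separates the two effects. *)
Lemma cd_step_expansive x y j : `|x| < rho -> `|y| < rho ->
  `|x - y| <= 5 * (N + 4) * `|step j x - step j y|.
Proof.
move=> /ltW xr /ltW yr; set w := step j x - step j y.
have wi i : i != j -> (x - y) i 0 = w i 0.
  by move=> ij; rewrite !mxE (negPf ij).
set t := (x - y) j 0; set z := y + t *: e_ j.
have zi i : z i 0 = if i == j then x j 0 else y i 0.
  rewrite !mxE /=; case: eqP => [->|_]; last by rewrite mulr0 addr0.
  by rewrite mulr1 /t !mxE addrC subrK.
have zr : `|z| <= rho.
  apply/sup_norm_le => [|i]; first exact: le_trans (normr_ge0 _) xr.
  by rewrite zi; case: eqP => _; exact: le_trans (entry_le_norm _ _) _.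
have xz : `|x - z| <= `|w|.
  apply/sup_norm_le => // i; have [->|ij] := eqVneq i j.
    by rewrite 2!mxE zi eqxx subrr normr0.
  have -> : (x - z) i 0 = (x - y) i 0 by rewrite 2!mxE zi (negPf ij) !mxE.
  by rewrite wi// entry_le_norm.
have r2 : 0 < gamma * rho ^+ 2 by rewrite mulr_gt0// exprn_gt0.
set c := - 4 * A j j + 4 * dotp y y + 4 * (x j 0 + y j 0) * x j 0.
have gz : grad z j - grad y j = t * c.
  have zy : z - y = t *: e_ j by rewrite /z addrC addKr.
  have zj : z j 0 = x j 0 by rewrite zi eqxx.
  have tj : t = x j 0 - y j 0 by rewrite /t !mxE.
  rewrite grad_sub zy -scalemxAr -colE dotpZr dotp_delta.
  have -> : dotp z z = dotp y y + t * (x j 0 + y j 0).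
    rewrite /z !(dotpDl, dotpDr, dotpZl, dotpZr) (dotpC (e_ j)) !dotp_delta.
    by rewrite mxE !eqxx tj /=; ring.
  have -> : (z + y) j 0 = x j 0 + y j 0 by rewrite mxE zj.
  by rewrite !mxE !eqxx /c tj /=; ring.
have cN : (N + 4) * (gamma * c) <= N + 3.
  have xj := le_trans (entry_le_norm x j) xr.
  have yj := le_trans (entry_le_norm y j) yr.
  have xyj : (x j 0 + y j 0) * x j 0 <= 2 * rho ^+ 2.
    apply: le_trans (ler_norm _) _; rewrite normrM.
    have -> : 2 * rho ^+ 2 = (rho + rho) * rho by ring.
    by rewrite ler_pM//; apply: le_trans (ler_normD _ _) _; rewrite lerD.
  have Aj := entry_le_sqr j j.
  have Aj' : - A j j <= rho ^+ 2 by move: Aj; rewrite ler_norml; lra.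
  have d2 := dotp_le_rho yr.
  have : gamma * c <= gamma * (4 * (N + 3) * rho ^+ 2).
    by rewrite ler_pM2l// /c; lra.
  move=> gc; have := gamma_le; have := N_ge1; nra.
have gxz : gamma * `|grad x j - grad z j| <= 4 * `|w|.
  have := grad_lipschitz j xr zr => gl.
  have : gamma * `|grad x j - grad z j| <= gamma * (16 * N * rho ^+ 2 * `|x - z|).
    by rewrite ler_pM2l.
  move=> H; apply: le_trans H _.
  have -> : gamma * (16 * N * rho ^+ 2 * `|x - z|) =
     (16 * N * (gamma * rho ^+ 2)) * `|x - z| by ring.
  rewrite ler_pM//; first by rewrite !mulr_ge0// ltW.
  by have := gamma_le; lra.
have tw : t * (1 - gamma * c) = w j 0 + gamma * (grad x j - grad z j).
  have -> : w j 0 = t - gamma * (grad x j - grad y j).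
    by rewrite /w /t !mxE eqxx; ring.
  have -> : grad x j - grad y j = (grad x j - grad z j) + t * c.
    by rewrite -gz addrA subrK.
  by ring.
have tN : `|t| <= 5 * (N + 4) * `|w|.
  have N4 : 0 < N + 4 by have := N_ge1; lra.
  have k1 : (N + 4)^-1 <= 1 - gamma * c.
    by rewrite -[_^-1]mulr1 ler_pdivrMl//; lra.
  have k0 : 0 < (N + 4)^-1 by rewrite invr_gt0.
  have : `|t| * (N + 4)^-1 <= `|t * (1 - gamma * c)|.
    by rewrite normrM ler_wpM2l// ger0_norm//; apply: le_trans k1; apply: ltW.
  rewrite tw ler_pdivrMr// => H; apply: le_trans H _.
  rewrite mulrAC ler_wpM2r ?(ltW N4)//.
  apply: le_trans (ler_normD _ _) _; rewrite normrM (gtr0_norm gamma_gt0).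
  by have := entry_le_norm w j; lra.
apply/sup_norm_le => [|i].
  by rewrite !mulr_ge0//; have := N_ge1; lra.
have [->//|ij] := eqVneq i j.
rewrite wi//; apply: le_trans (entry_le_norm _ _) _.
by rewrite -[leLHS]mul1r ler_wpM2r//; have := N_ge1; lra.
Qed.

End CoordinateStep.

(** * Convergence to an isolated zero *)

Section IsolatedZeros.
Variables (R : realType) (n : nat).
Implicit Types (x y z : 'cV[R]_n.+1) (s : seq 'cV[R]_n.+1).

Lemma norm_trmx (x : 'rV[R]_n.+1) : `|x^T| = `|x|.
Proof.
apply/le_anti/andP; split.
  apply/sup_norm_le => // i; rewrite mxE /Num.norm /= mx_normrE.
  by apply: (le_bigmax _ (fun ij => `|x ij.1 ij.2|) (0, i)).
rewrite {1}/Num.norm /= mx_normrE; apply/bigmax_leP; split=> // -[i j] _ /=.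
by have := entry_le_norm x^T j; rewrite mxE (ord1 i).
Qed.

(** Stated for an abstract normed module because filter inference on the
    concrete type of row vectors unfolds the matrix topology and gets stuck. *)
Lemma dist_continuous (V : normedModType R) (v : V) :
  continuous (fun w : V => `|w - v| : R).
Proof. by move=> w; apply: cvg_norm; apply: cvgB => //; exact: cvg_cst. Qed.

Lemma near_dist_lt (V : normedModType R) (v : V) (e : R) :
  0 < e -> \forall w \near v, `|v - w| < e.
Proof. exact: (@cvgr_dist_lt _ _ _ _ _ id). Qed.

(** Compactness of the part of the closed ball that stays at distance at least
    r from the zeros of phi. Transposition, an isometry, turns columns into row
    vectors, to which [bounded_closed_compact] and [EVT_min_rV] apply. *)
Lemma away_from_zeros_bounded_below (phi : 'cV[R]_n.+1 -> R) (L rho r : R) s :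
  (forall x y, `|x| <= rho -> `|y| <= rho -> `|phi x - phi y| <= L * `|x - y|) ->
  (forall x, `|x| <= rho -> phi x <= 0 -> x \in s) -> 0 < r ->
  exists2 m, 0 < m & forall x, `|x| <= rho ->
    (forall z, z \in s -> r <= `|x - z|) -> m <= phi x.
Proof.
move=> phiL zeros r0.
pose K : set 'rV[R]_n.+1 :=
  [set x | `|x| <= rho /\ forall z, z \in s -> r <= `|x - z^T|].
have distT x z : `|x - z| = `|x^T - z^T|.
  by rewrite -linearB -(norm_trmx (x - z)^T) trmxK.
have [K0|/set0P/negP/negPn/eqP K0] := pselect (K !=set0); last first.
  exists 1 => // x xr xs; exfalso.
  have : K x^T; last by rewrite K0.
  split=> [|z zs]; last by rewrite -distT; exact: xs.
  by rewrite -norm_trmx trmxK.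
have Kcpt : compact K.
  apply: bounded_closed_compact.
    exists rho; split=> [|M rM x [xr _]]; first exact: num_real.
    exact: le_trans xr (ltW rM).
  have -> : K = [set x : 'rV[R]_n.+1 | `|x| <= rho] `&`
      \bigcap_(z in [set` s]) [set x : 'rV[R]_n.+1 | r <= `|x - z^T|].
    apply/seteqP; split=> x [xr xs]; split=> // z zs; exact: xs.
  apply: closedI; [|apply: closed_bigI => z _].
    apply: (@closed_comp _ _ (fun x : 'rV[R]_n.+1 => `|x|) [set t | t <= rho]).
      by move=> x _; exact: norm_continuous.
    exact: closed_le.
  apply: (@closed_comp _ _ (fun x : 'rV[R]_n.+1 => `|x - z^T|) [set t | r <= t]).
    by move=> x _; exact: dist_continuous.
  exact: closed_ge.
have phiC : {within K, continuous (fun x : 'rV[R]_n.+1 => phi x^T)}.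
  apply/subspace_continuousP => x [xr _]; apply/cvgrPdist_lt => e e0.
  have e1 : 0 < e / (`|L| + 1) by rewrite divr_gt0// ltr_wpDl.
  near=> y.
  have yK : K y by near: y; exact: withinT.
  apply: le_lt_trans (phiL _ _ _ _) _; rewrite ?norm_trmx//; first by case: yK.
  rewrite distT !trmxK.
  have xy : `|x - y| < e / (`|L| + 1).
    near: y; apply: cvg_within.

    exact: (@near_dist_lt 'rV[R]_n.+1 x _ e1).
  apply: (@le_lt_trans _ _ ((`|L| + 1) * `|x - y|)).
    by rewrite ler_wpM2r// (le_trans (ler_norm L))// lerDl.
  by rewrite mulrC -ltr_pdivlMr// ltr_wpDl.
have [c /set_mem cK cmin] := EVT_min_rV K0 Kcpt phiC.
exists (phi c^T); last first.
  move=> x xr xs; have := cmin x^T; rewrite trmxK; apply; apply/mem_set.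
  split=> [|z zs]; last by rewrite -distT; exact: xs.
  by rewrite -norm_trmx trmxK.
rewrite ltNge; apply/negP => c0; have [cr cs] := cK.
have /cs : c^T \in s by apply: zeros; rewrite ?norm_trmx.
by rewrite trmxK subrr normr0 leNgt r0.
Unshelve. all: by end_near.
Qed.

Lemma seq_separated s : exists2 d : R, 0 < d &
  forall y z, y \in s -> z \in s -> `|y - z| < d -> y = z.
Proof.
have [d d0 ds] : exists2 d : R, 0 < d &
    forall p, p \in [seq (y, z) | y <- s, z <- s] -> `|p.1 - p.2| < d -> p.1 = p.2.
  elim: [seq _ | _ <- s, _ <- s] => [|p t [d d0 dt]]; first by exists 1.
  have [p12|p12] := eqVneq p.1 p.2.
    by exists d => // q; rewrite inE => /orP[/eqP->//|/dt].
  exists (Num.min d `|p.1 - p.2|); first by rewrite lt_min d0 normr_gt0 subr_eq0.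
  move=> q; rewrite inE lt_min => /orP[/eqP->|/dt qt] /andP[qd]; first by rewrite ltxx.
  by move=> _; exact: qt.
exists d => // y z ys zs; apply: (ds (y, z)).
by apply/allpairsP; exists (y, z).
Qed.

(** Eventually the sequence is close to one of the finitely many zeros, and
    its steps are too short to jump from one zero to another. *)
Lemma cvg_to_isolated_zero (phi : 'cV[R]_n.+1 -> R) (L rho : R) s
    (u : nat -> 'cV[R]_n.+1) :
  (forall x y, `|x| <= rho -> `|y| <= rho -> `|phi x - phi y| <= L * `|x - y|) ->
  (forall x, `|x| <= rho -> phi x <= 0 -> x \in s) ->
  (forall l, `|u l| <= rho) ->
  (forall e, 0 < e -> exists L0, forall l, (L0 <= l)%N -> `|u l.+1 - u l| < e) ->
  (forall e, 0 < e -> exists L0, forall l, (L0 <= l)%N -> phi (u l) < e) ->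
  exists2 z, z \in s & u l @[l --> \oo] --> z.
Proof.
move=> phiL zeros ur steps phi0.
have near_s r : 0 < r -> exists L0, forall l, (L0 <= l)%N ->
    exists2 z, z \in s & `|u l - z| < r.
  move=> r0; have [m m0 phim] := away_from_zeros_bounded_below phiL zeros r0.
  have [L0 L0P] := phi0 m m0; exists L0 => l /L0P um.
  apply: contrapT => H; move: um; rewrite ltNge phim// => z zs.
  by rewrite leNgt; apply/negP => uz; apply: H; exists z.
have [d d0 sep] := seq_separated s.
have d3 : 0 < d / 3 by rewrite divr_gt0.
have [L0 L0P] := near_s _ d3; have [L1 L1P] := steps _ d3.
(* The nearest zero does not change: two zeros that are both within d / 3 of
   consecutive terms, themselves d / 3 apart, are less than d apart. *)
pose M := maxn L0 L1.
have [z zs uz] := L0P M (leq_maxl _ _); exists z => //.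
have close l : (M <= l)%N -> `|u l - z| < d / 3.
  move=> /subnK <-; elim: (l - M)%N => [//|k IH]; rewrite addSn.
  have ML0 : (L0 <= (k + M).+1)%N by rewrite leqW// (leq_trans (leq_maxl L0 L1))// leq_addl.
  have ML1 : (L1 <= k + M)%N by rewrite (leq_trans (leq_maxr L0 L1))// leq_addl.
  have [z' z's uz'] := L0P _ ML0; have us := L1P _ ML1.
  suff -> : z = z' by [].
  apply: sep => //.
  have -> : z - z' = - (u (k + M)%N - z) - (u (k + M).+1 - u (k + M)%N) + (u (k + M).+1 - z').
    by apply/matrixP => a b; rewrite !mxE; ring.
  apply: le_lt_trans (ler_normD _ _) _.
  apply: le_lt_trans (lerD (ler_normB _ _) (lexx _)) _.
  by rewrite normrN; lra.
apply/cvgrPdist_lt => e e0.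
have me : 0 < Num.min e (d / 3) by rewrite lt_min e0.
have [L2 L2P] := near_s _ me.
exists (maxn M L2) => // l /=; rewrite geq_max => /andP[Ml L2l].
have [z' z's] := L2P _ L2l; rewrite lt_min => /andP[uze uzd].
suff -> : z = z' by rewrite distrC.
apply: sep => //.
have -> : z - z' = - (u l - z) + (u l - z') by apply/matrixP => a b; rewrite !mxE; ring.
apply: le_lt_trans (ler_normD _ _) _; rewrite normrN.
by have := close _ Ml; lra.
Qed.

End IsolatedZeros.

(** * Orbits converge to critical points *)

Section Orbits.
Variables (R : realType) (n : nat) (A : 'M[R]_n.+1) (rho gamma : R).
Hypothesis A_sym : A^T = A.
Hypothesis rho_gt0 : 0 < rho.
Hypothesis col_le : forall j, dotp (col j A) (col j A) <= rho ^+ 4.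
Hypothesis gamma_gt0 : 0 < gamma.
Hypothesis gamma_le : gamma * (4 * (n.+1%:R + 4) * rho ^+ 2) <= 1.
Implicit Types (x y z : 'cV[R]_n.+1).

Local Notation N := (n.+1%:R : R).
Local Notation grad := (objective_grad A).
Local Notation orbit := (cd_cyc_grad A gamma).
Local Notation active l := (inord (l %% n.+1) : 'I_n.+1).

(** The coordinate schedule has period N, so an orbit can be restarted at the
    beginning of any cycle. *)
Lemma orbit_shift x k m : orbit x (k * n.+1 + m) = orbit (orbit x (k * n.+1)) m.
Proof. by elim: m => [|m IH]; rewrite ?addn0// addnS /= IH modnMDl. Qed.

Lemma orbit_stays x l : `|x| < rho -> `|orbit x l| < rho.
Proof. by move=> xr; elim: l => [//|l IH]; exact: cd_step_stays. Qed.

Lemma orbit_expansive x y l : `|x| < rho -> `|y| < rho ->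
  `|x - y| <= (5 * (N + 4)) ^+ l * `|orbit x l - orbit y l|.
Proof.
move=> xr yr; elim: l => [|l IH]; first by rewrite expr0 mul1r.
apply: le_trans IH _; rewrite exprSr -mulrA ler_wpM2l ?exprn_ge0 ?mulr_ge0//.
by apply: (cd_step_expansive rho_gt0) => //; exact: orbit_stays.
Qed.

Lemma orbit_descent x l : `|x| < rho ->
  objective A (orbit x l.+1) <=
  objective A (orbit x l) - gamma / 2 * grad (orbit x l) (active l) ^+ 2.
Proof.
by move=> xr; apply: (cd_step_descent A_sym rho_gt0) => //; exact: orbit_stays.
Qed.

Lemma orbit_objective_le x l : `|x| < rho -> objective A (orbit x l) <= objective A x.
Proof.
move=> xr; elim: l => [//|l IH]; apply: le_trans IH.
apply: le_trans (orbit_descent l xr) _; rewrite lerBlDr lerDl.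
by rewrite mulr_ge0 ?sqr_ge0// divr_ge0// ltW.
Qed.

(** The decreases of the objective are summable, since it is nonnegative. *)
Lemma active_grad_small x e : `|x| < rho -> 0 < e ->
  exists L0, forall l, (L0 <= l)%N -> `|grad (orbit x l) (active l)| < e.
Proof.
move=> xr e0; pose f l := objective A (orbit x l).
have fS l : f l.+1 <= f l - gamma / 2 * grad (orbit x l) (active l) ^+ 2.
  exact: orbit_descent.
have fcvg : cvgn f.
  apply: nonincreasing_is_cvgn.
    apply/nonincreasing_seqP => l; apply: le_trans (fS l) _.
    by rewrite lerBlDr lerDl mulr_ge0 ?sqr_ge0// divr_ge0// ltW.
  by exists 0 => _ [l _ <-]; rewrite /f /objective sqr_ge0.
have d0 : 0 < gamma * e ^+ 2 / 4 by rewrite divr_gt0// mulr_gt0// exprn_gt0.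
have /cvgrPdist_lt/(_ _ d0) [L0 _ L0P] := fcvg.
exists L0 => l Ll; have := L0P l Ll; have := L0P l.+1 (leqW Ll) => /=.
rewrite 2!ltr_norml => /andP[_ f1] /andP[f2 _].
rewrite -ltr_sqr ?nnegrE ?(ltW e0)// real_normK ?num_real//.
rewrite -(ltr_pM2l gamma_gt0).
have := fS l; lra.
Qed.

Lemma orbit_step_small x e : `|x| < rho -> 0 < e ->
  exists L0, forall l, (L0 <= l)%N -> `|orbit x l.+1 - orbit x l| < e.
Proof.
move=> xr e0; have eg : 0 < e / gamma by rewrite divr_gt0.
have [L0 L0P] := active_grad_small xr eg; exists L0 => l /L0P.
rewrite ltr_pdivlMr// => gl /=; rewrite cd_stepE addrAC subrr add0r.
apply/(sup_norm_lt _ e0) => i; rewrite !mxE /= normrM normrN normrM (gtr0_norm gamma_gt0).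
by case: eqP => _; rewrite /= ?normr1 ?normr0 ?mulr0// mulr1 mulrC.
Qed.

Lemma active_within_cycle l (j : 'I_n.+1) :
  exists2 k, (k <= n)%N & active (l + k) = j.
Proof.
exists ((j + (n.+1 - l %% n.+1)) %% n.+1)%N; first by rewrite -ltnS ltn_pmod.
apply/val_inj; rewrite /= inordK ?ltn_pmod// modnDmr.
rewrite {1}(divn_eq l n.+1) -addnA modnMDl addnCA subnKC ?(ltnW (ltn_pmod _ _))//.
by rewrite modnDr modn_small.
Qed.

(** Every coordinate becomes active within the next N steps, during which the
    iterate, hence its gradient, hardly moves. *)
Lemma grad_small x e : `|x| < rho -> 0 < e ->
  exists L0, forall l, (L0 <= l)%N -> forall j, `|grad (orbit x l) j| < e.
Proof.
move=> xr e0; pose C := 16 * N * rho ^+ 2 * N.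
have C0 : 0 <= C by rewrite !mulr_ge0// ltW.
have e1 : 0 < e / (C + 1) by rewrite divr_gt0// ltr_wpDl.
have [L1 L1P] := active_grad_small xr e1.
have [L2 L2P] := orbit_step_small xr e1.
exists (maxn L1 L2) => l; rewrite geq_max => /andP[l1 l2] j.
have [k kn <-] := active_within_cycle l j.
have drift m : `|orbit x (l + m) - orbit x l| <= m%:R * (e / (C + 1)).
  elim: m => [|m IH]; first by rewrite addn0 subrr normr0 mul0r.
  have -> : orbit x (l + m.+1) - orbit x l = (orbit x (l + m).+1 - orbit x (l + m)%N) +
     (orbit x (l + m)%N - orbit x l) by rewrite addnS addrA subrK.
  apply: le_trans (ler_normD _ _) _; rewrite mulrSr mulrDl mul1r addrC lerD//.
  by apply/ltW/L2P; rewrite (leq_trans l2)// leq_addr.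
have := L1P (l + k)%N (leq_trans l1 (leq_addr _ _)).
have := grad_lipschitz rho_gt0 col_le (active (l + k)) (ltW (orbit_stays l xr))
  (ltW (orbit_stays (l + k) xr)).
set a := grad (orbit x l) _; set b := grad _ _; rewrite distrC => ab be.
have dk : `|orbit x l - orbit x (l + k)| <= N * (e / (C + 1)).
  rewrite distrC; apply: le_trans (drift k) _.
  by apply: ler_wpM2r; [exact: ltW|rewrite ler_nat leqW].
have -> : a = - (b - a) + b by rewrite opprB subrK.
apply: le_lt_trans (ler_normD _ _) _; rewrite normrN.
have eE : (C + 1) * (e / (C + 1)) = e.
  by rewrite mulrC divfK// gt_eqF// ltr_wpDl.
rewrite -[ltRHS]eE mulrDl mul1r.
apply: ler_ltD be; apply: le_trans ab _; rewrite /C -[leRHS]mulrA ler_wpM2l//.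
by rewrite !mulr_ge0// ltW.
Qed.

Lemma objective_lipschitz : exists C, forall x y, `|x| <= rho -> `|y| <= rho ->
  `|objective A x - objective A y| <= C * `|x - y|.
Proof.
pose a := N * rho ^+ 2; exists (2 * (N * (N * rho ^+ 2 * (rho + rho))) +
   N * (rho + rho) * (a + a)) => x y xr yr.
have sumr : `|x + y| <= rho + rho by rewrite (le_trans (ler_normD _ _))// lerD.
have -> : objective A x - objective A y = - 2 * dotp (x - y) (A *m (x + y)) +
   dotp (x + y) (x - y) * (dotp x x + dotp y y).
  rewrite !objectiveE mulmxDr -(scaleN1r y) !(dotpDl, dotpDr, dotpZl, dotpZr).
  by rewrite -(dotp_mulmxl x y A_sym) (dotpC y x) (dotpC y (A *m x)); ring.
apply: le_trans (ler_normD _ _) _; rewrite mulrDl lerD//.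
   rewrite normrM normrN normr_nat -[leRHS]mulrA; apply: ler_wpM2l => //.
  apply: le_trans (dotp_norm _ _) _; rewrite -[leRHS]mulrA; apply: ler_wpM2l => //.
  rewrite [leLHS]mulrC; apply: ler_wpM2r => //.
  apply: le_trans (mulmx_norm _ (entry_le_sqr rho_gt0 col_le)) _.
  by rewrite ler_wpM2l// mulr_ge0// sqr_ge0.
rewrite normrM mulrAC ler_pM//.
  apply: le_trans (dotp_norm _ _) _; rewrite -[leRHS]mulrA; apply: ler_wpM2l => //.
  exact: ler_wpM2r.
rewrite ger0_norm ?addr_ge0 ?dotp_ge0//.
by rewrite lerD// /a; exact: dotp_le_rho.
Qed.

Definition critical x := forall j, grad x j = 0.

Lemma orbit_cvg_critical (s : seq 'cV[R]_n.+1) x :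
  (forall z, critical z -> z \in s) -> `|x| < rho ->
  exists z, [/\ z \in s, orbit x l @[l --> \oo] --> z & objective A z <= objective A x].
Proof.
move=> crit_s xr; pose phi z := \sum_j `|grad z j|.
have xlr l := ltW (orbit_stays l xr).
have [z zs zlim] : exists2 z, z \in s & orbit x l @[l --> \oo] --> z.
  apply: (@cvg_to_isolated_zero _ _ phi (N * (16 * N * rho ^+ 2)) rho s (orbit x)) => //.
  - move=> y z yr zr; rewrite /phi -sumrB.
    apply: le_trans (ler_norm_sum _ _ _) _.
    apply: (@le_trans _ _ (\sum_(j < n.+1) 16 * N * rho ^+ 2 * `|y - z|)).
      apply: ler_sum => j _; apply: le_trans (ler_dist_dist _ _) _.
      exact: (grad_lipschitz rho_gt0).
    by rewrite sumr_const card_ord -[leRHS]mulrA [leRHS]mulr_natl.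
  - move=> z _ z0; apply: crit_s => j; apply/eqP; rewrite -normr_le0.
    apply: le_trans z0; rewrite /phi (bigD1 j)//= lerDl.
    exact: sumr_ge0.
  - by move=> e; exact: orbit_step_small.
  - move=> e e0; have eN : 0 < e / N by rewrite divr_gt0.
    have [L0 L0P] := grad_small xr eN; exists L0 => l /L0P gl.
    have -> : e = \sum_(j < n.+1) e / N.
      by rewrite sumr_const card_ord -[RHS]mulr_natr divfK// pnatr_eq0.
    by apply: ltr_sum => //; apply/hasP; exists ord0; rewrite ?mem_index_enum.
exists z; split=> //; have [C CP] := objective_lipschitz.
have zr : `|z| <= rho.
  by apply: (cvgr_to_le (cvg_norm zlim)); near=> l; exact: xlr.
rewrite leNgt; apply/negP => fxz; pose d := objective A z - objective A x.
have C1 : 0 < `|C| + 1 by rewrite ltr_wpDl.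
have d0 : 0 < d / (`|C| + 1) by rewrite divr_gt0 ?subr_gt0.
have /cvgrPdist_lt/(_ _ d0) [L0 _ L0P] := zlim.
have := L0P L0 (leqnn _) => /= zL; have := CP _ _ zr (xlr L0).
rewrite leNgt => /negP; apply; apply: (@le_lt_trans _ _ ((`|C| + 1) * `|z - orbit x L0|)).
  by rewrite ler_wpM2r// (le_trans (ler_norm C))// lerDl.
move: zL; rewrite (ltr_pdivlMr _ _ C1) mulrC => /lt_le_trans; apply.
apply: le_trans (ler_norm _); rewrite lerB//.
exact: orbit_objective_le.
Unshelve. all: by end_near.
Qed.

End Orbits.

(** * Simple eigenvalues and critical points *)

Section SimpleEigenvalues.
Variables (F : fieldType) (n : nat).
Implicit Types (B : 'M[F]_n.+1) (x y : 'rV[F]_n.+1) (a : F).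

(** Geometric multiplicity at most algebraic multiplicity, for a plane of
    eigenvectors. Replacing rows i and k of the identity matrix by x and y gives
    an invertible Q for which rows i and k of Q (X - B) are multiples of X - a;
    take determinants. The hypotheses on the entries say that x and y are
    independent, after elimination of coordinate i from y. *)
Lemma independent_eigenvectors_dvdp B x y a i k :
  x *m B = a *: x -> y *m B = a *: y ->
  x 0 i != 0 -> y 0 i = 0 -> y 0 k != 0 -> ('X - a%:P) ^+ 2 %| char_poly B.
Proof.
move=> xB yB xi yi yk.
have ki : k != i by apply: contra_neq yk => ->.
pose Q : 'M[F]_n.+1 := \matrix_(r, c)
  if r == i then x 0 c else if r == k then y 0 c else (r == c)%:R.
have rowQi : row i Q = x by apply/rowP => c; rewrite !mxE eqxx.
have rowQk : row k Q = y by apply/rowP => c; rewrite !mxE (negPf ki) eqxx.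
have Qunit : Q \in unitmx.
  rewrite -row_free_unit; apply: inj_row_free => v vQ.
  have vQc c : v 0 i * x 0 c + v 0 k * y 0 c +
      (if (c == i) || (c == k) then 0 else v 0 c) = 0.
    have := congr1 (fun M : 'rV[F]_n.+1 => M 0 c) vQ; rewrite !mxE => vQ0.
    rewrite -[RHS]vQ0 (bigD1 i)//= (bigD1 k)//= addrA; congr (_ + _ + _).
    - by rewrite mxE eqxx.
    - by rewrite mxE (negPf ki) eqxx.
    case: ifPn => [cik|/norP[ci ck]].
      rewrite big1// => r /andP[ri rk]; rewrite mxE (negPf ri) (negPf rk).
      by case: eqP => [rc|]; rewrite ?mulr0//; move: cik; rewrite -rc (negPf ri) (negPf rk).
    rewrite (bigD1 c) ?ci//= big1 ?addr0 => [|r /andP[/andP[ri rk] rc]].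
      by rewrite mxE (negPf ci) (negPf ck) eqxx mulr1.
    by rewrite mxE (negPf ri) (negPf rk) (negPf rc) mulr0.
  have vi : v 0 i = 0.
    have := vQc i; rewrite eqxx /= yi mulr0 !addr0 => /eqP.
    by rewrite mulf_eq0 (negPf xi) orbF => /eqP.
  have vk : v 0 k = 0.
    have := vQc k; rewrite eqxx orbT vi mul0r add0r addr0 => /eqP.
    by rewrite mulf_eq0 (negPf yk) orbF => /eqP.
  apply/rowP => c; rewrite mxE; have := vQc c; rewrite vi vk !mul0r !add0r.
  by case: eqP => [->|_] //=; case: eqP => [->|_].
move: Q rowQi rowQk Qunit => Q rowQi rowQk Qunit.
pose q := 'X - a%:P.
pose d : 'rV[{poly F}]_n.+1 := \row_r if (r == i) || (r == k) then q else 1.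
pose Qp := map_mx polyC Q.
pose C : 'M[{poly F}]_n.+1 := \matrix_(r, c)
  if (r == i) || (r == k) then (Q r c)%:P else (Qp *m char_poly_mx B) r c.
have QB r : (r == i) || (r == k) -> row r Q *m B = a *: row r Q.
  by case/orP => /eqP ->; rewrite ?rowQi ?rowQk.
have QBC : Qp *m char_poly_mx B = diag_mx d *m C.
  apply/matrixP => r c; rewrite mul_diag_mx [in RHS]mxE [d _ _]mxE [C _ _]mxE.
  case: ifPn => [rik|_]; last by rewrite mul1r.
  rewrite /char_poly_mx mulmxBr mul_mx_scalar -map_mxM !mxE.
  have -> : \sum_j Q r j * B j c = (row r Q *m B) 0 c.
    by rewrite mxE; apply: eq_bigr => j _; rewrite [row _ _ _ _]mxE.
  by rewrite (QB r rik) !mxE rmorphM /q mulrBl.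
have := congr1 determinant QBC; rewrite !det_mulmx det_diag.
have -> : \prod_r d 0 r = q ^+ 2.
  rewrite (bigD1 i)//= (bigD1 k)//= big1 => [|r /andP[ri rk]].
    by rewrite !mxE !eqxx orbT mulr1 expr2.
  by rewrite mxE (negPf ri) (negPf rk).
rewrite /Qp det_map_mx => detE.
have detQ : \det Q != 0 by rewrite -unitfE -unitmxE.
have : q ^+ 2 %| (\det Q)%:P * char_poly B by rewrite /char_poly detE dvdp_mulr.
by rewrite mul_polyC dvdpZr.
Qed.

Lemma simple_eigenvector_unique B x y a :
  x *m B = a *: x -> y *m B = a *: y -> x != 0 ->
  ~~ (('X - a%:P) ^+ 2 %| char_poly B) -> exists c, y = c *: x.
Proof.
move=> xB yB /rV0Pn[i xi] simple; exists (y 0 i / x 0 i); apply/eqP.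
rewrite -subr_eq0; apply: contraNT simple => /rV0Pn[k yk].
apply: (independent_eigenvectors_dvdp xB _ xi _ yk).
  by rewrite mulmxBl -scalemxAl yB xB scalerBr !scalerA mulrC.
by rewrite !mxE divfK// subrr.
Qed.

End SimpleEigenvalues.

Section CriticalPoints.
Variables (R : realType) (n : nat) (A : 'M[R]_n.+1) (lambda : 'I_n.+1 -> R).
Hypothesis A_sym : A^T = A.
Hypothesis A_eigenvalues : char_poly A = \prod_(i < n.+1) ('X - (lambda i)%:P).
Hypothesis lambda_le : forall i, lambda i <= lambda ord0.
Hypothesis lambda1_gt0 : 0 < lambda ord0.
Hypothesis pos_eigenvalues_distinct :
  forall i j : 'I_n.+1, 0 < lambda i -> lambda i = lambda j -> i = j.
Implicit Types (x y z w : 'cV[R]_n.+1).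

Lemma sym_eigenP x a : A *m x = a *: x <-> x^T *m A = a *: x^T.
Proof.
split=> [Ax|/(congr1 trmx)]; first by rewrite -{1}A_sym -trmx_mul Ax linearZ.
by rewrite trmx_mul A_sym linearZ /= trmxK.
Qed.

Lemma eigenvector_exists i : exists2 x : 'cV[R]_n.+1, x != 0 & A *m x = lambda i *: x.
Proof.
have : eigenvalue A (lambda i).
  rewrite eigenvalue_root_char A_eigenvalues /root horner_prod (bigD1 i)//=.
  by rewrite hornerXsubC subrr mul0r.
move=> /eigenvalueP[v vA v0]; exists v^T; last by apply/sym_eigenP; rewrite trmxK.
by apply: contra_neq v0 => /(congr1 trmx); rewrite trmxK trmx0.
Qed.

Lemma eigenvalue_listed x a : x != 0 -> A *m x = a *: x -> exists i, a = lambda i.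
Proof.
move=> x0 /sym_eigenP xA.
have : eigenvalue A a.
  apply/eigenvalueP; exists x^T => //.
  by apply: contra_neq x0 => /(congr1 trmx); rewrite trmxK trmx0.
rewrite eigenvalue_root_char A_eigenvalues /root horner_prod.
move=> /prodf_eq0[i _]; rewrite hornerXsubC subr_eq0 => /eqP ->.
by exists i.
Qed.

Lemma pos_eigenvector_unique i x y : 0 < lambda i -> x != 0 ->
  A *m x = lambda i *: x -> A *m y = lambda i *: y -> exists c, y = c *: x.
Proof.
move=> li x0 /sym_eigenP xA /sym_eigenP yA.
have xT0 : x^T != 0 by apply: contra_neq x0 => /(congr1 trmx); rewrite trmxK trmx0.
suff simple : ~~ (('X - (lambda i)%:P) ^+ 2 %| char_poly A).
  have [c yc] := simple_eigenvector_unique xA yA xT0 simple.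
  by exists c; rewrite -[y]trmxK yc linearZ /= trmxK.
rewrite A_eigenvalues (bigD1 i)//= expr2 dvdp_mul2l ?polyXsubC_eq0//.
rewrite dvdp_XsubCl /root horner_prod; apply/prodf_neq0 => j ji.
rewrite hornerXsubC subr_eq0; apply: contra ji => /eqP.
by move=> /(pos_eigenvalues_distinct li) ->.
Qed.

Lemma eigenvectors_orthogonal x y a b : a != b ->
  A *m x = a *: x -> A *m y = b *: y -> dotp x y = 0.
Proof.
move=> ab Ax Ay; apply/eqP; have := dotp_mulmxl x y A_sym.
rewrite Ax Ay dotpZl dotpZr => /eqP; rewrite -subr_eq0 -mulrBl mulf_eq0.
by rewrite subr_eq0 (negPf ab).
Qed.

Lemma criticalP z : critical A z <-> A *m z = dotp z z *: z.
Proof.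
split=> [cz|Az j]; last by rewrite objective_gradE Az mxE; ring.
apply/matrixP => j k; rewrite ord1 [RHS]mxE.
by have := cz j; rewrite objective_gradE; lra.
Qed.

Lemma critical_eigenvalue z : critical A z -> z != 0 ->
  exists2 i, 0 < lambda i & dotp z z = lambda i.
Proof.
move=> /criticalP Az z0; have [i zi] := eigenvalue_listed z0 Az.
by exists i; rewrite -?zi ?dotp_gt0.
Qed.

(** Only a positive eigenvalue can be the squared norm of a nonzero critical
    point; it is simple, and its eigenline contains two opposite vectors of
    that norm. *)
Lemma critical_finite : exists s : seq 'cV[R]_n.+1, forall z, z \in s <-> critical A z.
Proof.
have /choice[p pP] : forall i, exists p, forall z, critical A z -> z != 0 ->
    dotp z z = lambda i -> z = p \/ z = - p.
  move=> i; have [[p [cp p0 pl]]|no] := pselect (exists p,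
    [/\ critical A p, p != 0 & dotp p p = lambda i]); last first.
    by exists 0 => z cz z0 zl; exfalso; apply: no; exists z.
  exists p => z cz z0 zl.
  have li : 0 < lambda i by rewrite -pl dotp_gt0.
  have Ap : A *m p = lambda i *: p by rewrite -pl; apply/criticalP.
  have Az : A *m z = lambda i *: z by rewrite -zl; apply/criticalP.
  have [c zc] := pos_eigenvector_unique li p0 Ap Az.
  have : c ^+ 2 = 1.
    apply: (mulIf (lt0r_neq0 li)); rewrite mul1r -{2}zl zc dotpZl dotpZr pl.
    by rewrite expr2 mulrA.
  move=> /eqP; rewrite sqrf_eq1 zc => /orP[]/eqP->; [left|right].
    by rewrite scale1r.
  by rewrite scaleN1r.
pose s := 0 :: [seq p i | i <- enum 'I_n.+1] ++ [seq - p i | i <- enum 'I_n.+1].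
exists [seq z <- s | `[< critical A z >]] => z; rewrite mem_filter.
split=> [/andP[/asboolP//]|cz]; apply/andP; split; first exact/asboolP.
rewrite inE; have [//|z0] := eqVneq z 0; rewrite mem_cat /=.
have [i _ zi] := critical_eigenvalue cz z0.
by apply/orP; case: (pP i z cz z0 zi) => ->; [left|right];
  apply: map_f; rewrite mem_enum.
Qed.

Lemma objective_critical z : critical A z ->
  objective A z = \sum_i \sum_j A i j ^+ 2 - dotp z z ^+ 2.
Proof. by move=> /criticalP Az; rewrite objectiveE Az dotpZr; ring. Qed.

Lemma critical_dotp_le z : critical A z -> dotp z z <= lambda ord0.
Proof.
move=> cz; have [->|z0] := eqVneq z 0.
  by rewrite /dotp big1 ?ltW// => i _; rewrite mxE mul0r.
by have [i _ ->] := critical_eigenvalue cz z0.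
Qed.

(** The descent itself proves global minimality: from a competitor y, run it in
    a ball that contains y, with a stepsize adapted to that ball; it converges
    to a critical point whose value is at most f y and, by
    [objective_critical], at least f z. *)
Lemma top_critical_global_minimizer z : critical A z -> dotp z z = lambda ord0 ->
  global_minimizer (objective A) z.
Proof.
move=> cz zl y.
pose c := \sum_j Num.sqrt (dotp (col j A) (col j A)).
(* r ^+ 2 has to dominate the norms of the columns; 1 <= r gives r <= r ^+ 2. *)
pose r := 1 + c + `|y|.
have c0 : 0 <= c by apply: sumr_ge0 => j _; rewrite sqrtr_ge0.
have y0 : 0 <= `|y| by [].
have r1 : 1 <= r by rewrite /r; lra.
have r0 : 0 < r by lra.
have col_r j : dotp (col j A) (col j A) <= r ^+ 4.
  have cj : Num.sqrt (dotp (col j A) (col j A)) <= r ^+ 2.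
    apply: (@le_trans _ _ c).
      rewrite /c (bigD1 j)//= lerDl; apply: sumr_ge0 => k _; exact: sqrtr_ge0.
    apply: (@le_trans _ _ r); first by rewrite /r; lra.
    by rewrite expr2 ler_peMr// ltW.
  rewrite -[leLHS]sqr_sqrtr ?dotp_ge0// -[4%N]/(2 * 2)%N exprM.
  by rewrite ler_sqr// nnegrE ?sqrtr_ge0// exprn_ge0// ltW.
have k0 : 0 < 4 * (n.+1%:R + 4) * r ^+ 2 :> R.
  by apply: mulr_gt0; [apply: mulr_gt0 => //; rewrite ltr_wpDl|exact: exprn_gt0].
have yr : `|y| < r by rewrite /r; lra.
have [s sP] := critical_finite.
have g0 : 0 < (4 * (n.+1%:R + 4) * r ^+ 2)^-1 by rewrite invr_gt0.
have gl : (4 * (n.+1%:R + 4) * r ^+ 2)^-1 * (4 * (n.+1%:R + 4) * r ^+ 2) <= 1.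
  by rewrite mulVf// gt_eqF.
have [z' [/sP cz' _ fz']] := orbit_cvg_critical A_sym r0 col_r g0 gl
  (fun z => (sP z).2) yr.
apply: le_trans fz'; rewrite !objective_critical// zl lerD2l lerN2.
rewrite ler_sqr ?critical_dotp_le// nnegrE ?dotp_ge0//.
exact: ltW.
Qed.

Definition hessian z : 'M[R]_n.+1 :=
  (- 4) *: A + (4 * dotp z z)%:M + 8 *: (z *m z^T).

Lemma hessian_mulmx z v :
  hessian z *m v = (- 4) *: (A *m v) + (4 * dotp z z) *: v + (8 * dotp z v) *: z.
Proof.
rewrite /hessian !mulmxDl -!scalemxAl mul_scalar_mx -mulmxA.
by rewrite (mx11_scalar (z^T *m v)) -dotp_mx mul_mx_scalar !scalerA.
Qed.

(** The direction w is the top eigenvector. It is orthogonal to z, so that its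
    curvature is 4 (|z|^2 - lambda_0) |w|^2. *)
Lemma nonminimal_critical_strict_saddle z : critical A z ->
  ~ global_minimizer (objective A) z -> exists w, dotp w (hessian z *m w) < 0.
Proof.
move=> cz nmin; have zl : dotp z z < lambda ord0.
  rewrite lt_neqAle critical_dotp_le// andbT; apply/eqP => zl; apply: nmin.
  exact: top_critical_global_minimizer.
have [w w0 Aw] := eigenvector_exists ord0; exists w.
have zw : dotp z w = 0.
  apply: (eigenvectors_orthogonal _ _ Aw); last exact/criticalP.
  by rewrite lt_eqF.
rewrite hessian_mulmx Aw zw mulr0 scale0r addr0 scalerA -scalerDl dotpZr.
by rewrite pmulr_llt0 ?dotp_gt0//; lra.
Qed.

End CriticalPoints.

(** * Perturbed coordinate descent for a quadratic form *)

Section PerturbedQuadraticCycle.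
Variables (R : realType) (n : nat).
Implicit Types (H : 'M[R]_n.+1) (u : 'cV[R]_n.+1) (v : nat -> 'cV[R]_n.+1).

Local Notation N := (n.+1%:R : R).
Local Notation e_ j := (delta_mx j 0 : 'cV[R]_n.+1).

Definition qform H u : R := dotp u (H *m u).

Lemma qform_line H u j t : H^T = H ->
  qform H (u + t *: e_ j) = qform H u + 2 * t * (H *m u) j 0 + t ^+ 2 * H j j.
Proof.
move=> HT; have Ae : (H *m e_ j) j 0 = H j j by rewrite -colE mxE.
rewrite /qform mulmxDr -scalemxAr !(dotpDl, dotpDr, dotpZl, dotpZr).
rewrite -(dotp_mulmxl u (e_ j) HT) !(dotpC (e_ j)) !dotp_delta Ae.
ring.
Qed.

Lemma entry_bound H : exists2 M, 0 <= M & forall i j, `|H i j| <= M.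
Proof.
exists (\sum_i \sum_j `|H i j|); first by do 2!apply: sumr_ge0 => ? _.
move=> i j; rewrite (bigD1 i)//= (bigD1 j)//= -addrA lerDl addr_ge0//.
  exact: sumr_ge0.
by do 2!apply: sumr_ge0 => ? _.
Qed.

(** The kernel of H does not contribute to the form, so the form is controlled
    by H u even for singular H: with a pseudo-inverse P of H, H = H P H gives
    u^T H u = (H u)^T P (H u). *)
Lemma qform_le_gradient H : H^T = H ->
  exists2 K, 0 < K & forall u, `|qform H u| <= K * `|H *m u| ^+ 2.
Proof.
move=> HT; have [M M0] := entry_bound (pinvmx H).
have := mulmxKpV (submx_refl H); move: (pinvmx H) => P HPH HM.
exists (N * (N * M) + 1); first by rewrite ltr_wpDl// !mulr_ge0.
move=> u; have -> : qform H u = dotp (H *m u) (P *m (H *m u)).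
  by rewrite dotp_mulmxl// /qform !mulmxA HPH.
apply: le_trans (dotp_norm _ _) _; rewrite mulrDl mul1r.
apply: (@le_trans _ _ (N * (N * M) * `|H *m u| ^+ 2)); last by rewrite lerDl sqr_ge0.
rewrite -mulrA ler_wpM2l// expr2 [leRHS]mulrCA ler_wpM2l//.
exact: mulmx_norm.
Qed.

(** One cycle of coordinate descent for half the form of H, in which the
    partial derivative used at time m carries an error of relative size delta. *)
Definition perturbed_cycle H (gamma delta : R) v :=
  exists2 e : nat -> R,
    forall m, (m < n.+1)%N -> `|e m| <= delta * `|v m| &
    forall m, (m < n.+1)%N ->
      v m.+1 = v m + (- (gamma * ((H *m v m) (inord m) 0 + e m))) *: e_ (inord m).

Lemma sum_sqr_le (a : nat -> R) :
  (\sum_(m < n.+1) a m) ^+ 2 <= N * \sum_(m < n.+1) a m ^+ 2.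
Proof.
have := dotp_cauchy_schwarz (\col_(m < n.+1) a m) (const_mx 1).
rewrite /dotp; under eq_bigr do rewrite !mxE mulr1.
move/le_trans; apply; rewrite mulrC ler_pM ?sumr_ge0//=.
- by move=> i _; rewrite mxE mulr1.
- by move=> i _; rewrite mxE -expr2 sqr_ge0.
- by under eq_bigr do rewrite mxE mulr1; rewrite sumr_const card_ord.
by under eq_bigr do rewrite mxE -expr2.
Qed.

(** A step lowers the form by about gamma h_m^2, where h_m is the entry of H v_m
    that it uses. If all h_m are small then v hardly moves during the cycle, so
    the h_m are close to the entries of H v_0; hence the sum of the h_m^2
    dominates |H v_0|^2, up to the errors. The constants depend on H only
    through the bound M, because [negative_cone_expansion] chooses its shift of
    H after them. *)
Lemma cycle_decrease (gamma M : R) : 0 < gamma -> 0 <= M ->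
  exists c C, [/\ 0 < c, 0 < C & forall H delta v, H^T = H ->
    (forall i j, `|H i j| <= M) -> (forall j, gamma * H j j <= 1) ->
    0 <= delta <= 1 -> perturbed_cycle H gamma delta v ->
    qform H (v n.+1) <=
    qform H (v 0%N) - c * `|H *m v 0%N| ^+ 2 + C * delta ^+ 2 * `|v 0%N| ^+ 2].
Proof.
move=> g0 M0; have N0 : 0 < N by rewrite ltr0n.
pose C1 := (1 + gamma * (N * M + 1)) ^+ n.+1; pose C2 := 1 + N * M * gamma.
have NM0 : 0 <= N * M by rewrite mulr_ge0// ltW.
have G1 : 1 <= 1 + gamma * (N * M + 1).
  by rewrite lerDl mulr_ge0 ?(ltW g0)// addr_ge0.
have C1_gt0 : 0 < C1 by rewrite exprn_gt0// (lt_le_trans ltr01).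
have C2_gt0 : 0 < C2 by rewrite ltr_wpDr// mulr_ge0// ltW.
exists (gamma / (2 * N * C2 ^+ 2)), (2 * gamma * N * C1 ^+ 2); split.
- by rewrite divr_gt0// !mulr_gt0// exprn_gt0.
- by rewrite !mulr_gt0// exprn_gt0.
move=> H d v HT HM Hjj /andP[d0 d1] [e ed vS].
pose h m := (H *m v m) (inord m) 0.
have hM m : `|h m| <= N * M * `|v m|.
  exact: le_trans (entry_le_norm _ _) (mulmx_norm _ HM).
have stepE m : (m < n.+1)%N -> `|v m.+1 - v m| <= gamma * (`|h m| + d * `|v m|).
  move=> mn; rewrite vS// addrAC subrr add0r.
  apply/sup_norm_le => [|i]; first by rewrite mulr_ge0 ?addr_ge0 ?mulr_ge0// ltW.
  have le1 : `|gamma * (h m + e m)| <= gamma * (`|h m| + d * `|v m|).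
    rewrite normrM (gtr0_norm g0) ler_pM2l//.
    by apply: le_trans (ler_normD _ _) _; rewrite lerD// ed.
  rewrite -/(h m) mxE [e_ _ _ _]mxE eqxx andbT normrM normrN; case: eqP => _ /=; rewrite ?normr1 ?mulr1//.
  by rewrite normr0 mulr0 (le_trans _ le1).
(* Crude exponential growth bound, enough for the error terms. *)
have vC1 m : (m <= n.+1)%N -> `|v m| <= C1 * `|v 0%N|.
  move=> mn; apply: (@le_trans _ _ ((1 + gamma * (N * M + 1)) ^+ m * `|v 0%N|)).
    elim: m mn => [|m IH] mn; first by rewrite expr0 mul1r.
    have -> : v m.+1 = (v m.+1 - v m) + v m by rewrite subrK.
    apply: le_trans (ler_normD _ _) _; apply: le_trans (lerD (stepE _ mn) (lexx _)) _.
    rewrite exprS -mulrA.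
    apply: (@le_trans _ _ ((1 + gamma * (N * M + 1)) * `|v m|)); last first.
      by rewrite ler_wpM2l ?(le_trans ler01)// IH// ltnW.
    rewrite mulrDl mul1r addrC lerD2l -mulrA ler_pM2l// mulrDl lerD//.
    by rewrite ler_wpM2r.
  by rewrite ler_wpM2r// ler_weXn2l.
(* D bounds the total displacement during the cycle, up to the factor gamma. *)
pose D := \sum_(m < n.+1) (`|h m| + d * `|v m|).
have term0 m : 0 <= `|h m| + d * `|v m| by rewrite addr_ge0// mulr_ge0.
have D0 : 0 <= D by apply: sumr_ge0.
have vD m : (m <= n.+1)%N -> `|v m - v 0%N| <= gamma * D.
  move=> mn; apply: (@le_trans _ _ (gamma * \sum_(k < m) (`|h k| + d * `|v k|))).
    elim: m mn => [|m IH] mn; first by rewrite subrr normr0 big_ord0 mulr0.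
    have -> : v m.+1 - v 0%N = (v m - v 0%N) + (v m.+1 - v m).
      by rewrite [RHS]addrC addrA subrK.
    apply: le_trans (ler_normD _ _) _; rewrite big_ord_recr mulrDr lerD ?stepE//.
    by rewrite IH// ltnW.
  rewrite ler_pM2l// /D -!(big_mkord xpredT (fun k => `|h k| + d * `|v k|)).
  by rewrite (big_cat_nat (leq0n m) mn)//= lerDl; apply: sumr_ge0.
have HD : `|H *m v 0%N| <= C2 * D.
  apply/sup_norm_le => [|j]; first by rewrite mulr_ge0 ?(ltW C2_gt0).
  have jn := ltn_ord j.
  have -> : (H *m v 0%N) j 0 = h j - (H *m (v j - v 0%N)) j 0.
    by rewrite /h inord_val mulmxBr !mxE opprB addrCA subrr addr0.
  apply: le_trans (ler_normB _ _) _; rewrite /C2 mulrDl mul1r lerD//.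
    rewrite /D (bigD1 j)//= -addrA lerDl addr_ge0 ?mulr_ge0//.
    exact: sumr_ge0.
  apply: le_trans (entry_le_norm _ _) _; apply: le_trans (mulmx_norm _ HM) _.
  by rewrite -[leRHS]mulrA ler_wpM2l// vD// ltnW.
have qS m : (m < n.+1)%N -> qform H (v m.+1) <=
    qform H (v m) - gamma * h m ^+ 2 + gamma * d ^+ 2 * (C1 * `|v 0%N|) ^+ 2.
  move=> mn; rewrite vS// qform_line// -/(h m).
  have e2 : e m ^+ 2 <= d ^+ 2 * (C1 * `|v 0%N|) ^+ 2.
    rewrite -exprMn -[leLHS]real_normK ?num_real// ler_sqr ?nnegrE ?mulr_ge0 ?(ltW C1_gt0)//.
    apply: le_trans (ed _ mn) _; rewrite ler_wpM2l//; apply: vC1; exact: ltnW.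
  have ge := ler_wpM2l (ltW g0) e2.
  have Hj := Hjj (inord m); set a := H _ _ in Hj *.
  have gs : 0 <= gamma * (h m + e m) ^+ 2 by rewrite mulr_ge0 ?sqr_ge0// ltW.
  have := ler_wpM2l gs Hj; lra.
have qN : qform H (v n.+1) <= qform H (v 0%N) - gamma * \sum_(m < n.+1) h m ^+ 2 +
    N * (gamma * d ^+ 2 * (C1 * `|v 0%N|) ^+ 2).
  set B := gamma * d ^+ 2 * _.
  suff qm m : (m <= n.+1)%N -> qform H (v m) <=
      qform H (v 0%N) - gamma * \sum_(k < m) h k ^+ 2 + m%:R * B by exact: qm.
  elim: m => [|m IH] mn; first by rewrite big_ord0; lra.
  apply: le_trans (qS m mn) _; rewrite -/B big_ord_recr /= -natr1.
  have := IH (ltnW mn); lra.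
have sumv : D <= \sum_(m < n.+1) `|h m| + N * (d * (C1 * `|v 0%N|)).
  rewrite /D big_split /= lerD2l.
  have -> : N * (d * (C1 * `|v 0%N|)) = \sum_(m < n.+1) d * (C1 * `|v 0%N|).
    by rewrite sumr_const card_ord mulr_natl.
  by apply: ler_sum => m _; rewrite ler_wpM2l// vC1// ltnW.
have sumh := sum_sqr_le (fun m => `|h m|).
have sumh2 : \sum_(m < n.+1) `|h m| ^+ 2 = \sum_(m < n.+1) h m ^+ 2.
  by apply: eq_bigr => m _; rewrite real_normK ?num_real.
rewrite sumh2 in sumh; set S := \sum_(m < n.+1) h m ^+ 2 in qN sumh *.
set T := \sum_(m < n.+1) `|h m| in sumh sumv *.
set X := d * (C1 * `|v 0%N|) in sumv *.
have D2 : D ^+ 2 <= 2 * N * S + 2 * (N * X) ^+ 2.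
  have T0 : 0 <= T by apply: sumr_ge0.
  have X0 : 0 <= N * X by rewrite !mulr_ge0 // ltW.
  apply: (@le_trans _ _ ((T + N * X) ^+ 2)).
    by rewrite ler_sqr ?nnegrE ?addr_ge0.
  have := sqr_ge0 (T - N * X); lra.
have H2 : `|H *m v 0%N| ^+ 2 <= C2 ^+ 2 * D ^+ 2.
  by rewrite -exprMn ler_sqr ?nnegrE ?mulr_ge0 ?(ltW C2_gt0)//.
have cH : gamma / (2 * N * C2 ^+ 2) * `|H *m v 0%N| ^+ 2 <= gamma * S + gamma * N * X ^+ 2.
  rewrite mulrAC ler_pdivrMr ?mulr_gt0 ?exprn_gt0//.
  have k0 : 0 <= gamma * C2 ^+ 2 by rewrite mulr_ge0 ?sqr_ge0// ltW.
  have := ler_wpM2l k0 D2; have := ler_wpM2l (ltW g0) H2; lra.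
have XE : gamma * d ^+ 2 * (C1 * `|v 0%N|) ^+ 2 = gamma * X ^+ 2.
  by rewrite /X; ring.
rewrite XE in qN; apply: le_trans qN _.
have -> : 2 * gamma * N * C1 ^+ 2 * d ^+ 2 * `|v 0%N| ^+ 2 = 2 * (gamma * N * X ^+ 2).
  by rewrite /X; ring.
set k := gamma / _ in cH *.
have -> : N * (gamma * X ^+ 2) = gamma * N * X ^+ 2 by ring.
lra.
Qed.

(** The shifted form H' = H + e is used instead of H because H may be singular.
    Where it is negative, H has a value below - e |v|^2, so that
    [qform_le_gradient] bounds |v|^2 by a multiple of |H' v|^2 / e. The errors,
    which are of order e^2 |v|^2 once the shift is counted as an error, are thus
    of order e |H' v|^2 and are absorbed by the decrease c |H' v|^2 for small e.
    As |H' v|^2 dominates the form, the decrease is a fixed proportion of it. *)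
Lemma negative_cone_expansion (gamma mu : R) H w : 0 < gamma -> 0 < mu -> H^T = H ->
  (forall j, gamma * (H j j + mu) <= 1) -> qform H w < 0 ->
  exists H' delta eta, [/\ 0 < delta, 0 < eta, qform H' w < 0 &
    forall v, perturbed_cycle H gamma delta v -> qform H' (v 0%N) < 0 ->
    qform H' (v n.+1) <= (1 + eta) * qform H' (v 0%N)].
Proof.
move=> g0 mu0 HT Hjj qw.
have [M M0 HM] := entry_bound H.
have [K K0 HK] := qform_le_gradient HT.
have [c [C [c0 C0 dec]]] := cycle_decrease g0 (addr_ge0 M0 ler01).
pose ww := dotp w w.
have ww0 : 0 <= ww by exact: dotp_ge0.
have [e [e0 e1 eK eC [emu ew]]] : exists e, [/\ 0 < e, 2 * e <= 1, 4 * K * e <= 1,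
    32 * C * K * e <= c & e <= mu /\ e * (ww + 1) <= - qform H w].
  pose l := Num.min (1 / 2) (Num.min (1 / (4 * K)) (Num.min (c / (32 * C * K))
    (Num.min mu (- qform H w / (ww + 1))))).
  have w1 : 0 < ww + 1 by lra.
  have K4 : 0 < 4 * K by lra.
  have CK : 0 < 32 * C * K by rewrite !mulr_gt0.
  exists l; have : l <= l by [].
  rewrite {2}/l !le_min => /and5P[l1 l2 l3 l4 l5]; split=> //.
  - by rewrite /l !lt_min mu0 !divr_gt0//; lra.
  - lra.
  - by move: l2; rewrite ler_pdivlMr// mulrC.
  - by move: l3; rewrite ler_pdivlMr// mulrC.
  by split=> //; move: l5; rewrite ler_pdivlMr.
pose H' := H + e%:M.
have H'E u : H' *m u = H *m u + e *: u by rewrite mulmxDl mul_scalar_mx.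
have q'E u : qform H' u = qform H u + e * dotp u u.
  by rewrite /qform H'E dotpDr dotpZr.
exists H', e, (c / (8 * K)); split=> //.
- by rewrite divr_gt0// mulr_gt0.
- by rewrite q'E -/ww; move: ew; lra.
move=> v [a ae vS] qv; set u := v 0%N in qv *.
have H'T : H'^T = H' by rewrite /H' linearD /= HT tr_scalar_mx.
have H'M i j : `|H' i j| <= M + 1.
  rewrite !mxE (le_trans (ler_normD _ _))// lerD//.
  by rewrite normrMn gtr0_norm//; case: eqP => _ /=; rewrite ?mulr1n ?mulr0n; lra.
have H'jj j : gamma * H' j j <= 1.
  apply: le_trans (Hjj j); rewrite ler_pM2l// !mxE eqxx mulr1n lerD2l.
  exact: emu.
have de : 0 <= 2 * e <= 1 by rewrite e1 andbT; lra.
have pc : perturbed_cycle H' gamma (2 * e) v.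
  exists (fun m => a m - e * v m (inord m) 0) => m mn.
    apply: le_trans (ler_normB _ _) _; rewrite mulrDl mul1r mulrDl lerD ?ae//.
    by rewrite normrM gtr0_norm// ler_pM2l// entry_le_norm.
  rewrite vS//; congr (_ + (- (gamma * _)) *: _).
  by rewrite H'E [X in _ = X + _]mxE [(e *: v m) _ _]mxE; ring.
have := dec H' _ v H'T H'M H'jj de pc; rewrite -/u.
set h := `|H' *m u|; set x := `|u| => qdec.
have Hu : `|H *m u| <= h + e * x.
  have -> : H *m u = H' *m u - e *: u by rewrite H'E addrK.
  by apply: le_trans (ler_normB _ _) _; rewrite normrZ gtr0_norm.
have h0 : 0 <= h := normr_ge0 _.
have x0 : 0 <= x := normr_ge0 _.
have Hu2 : `|H *m u| ^+ 2 <= 2 * h ^+ 2 + 2 * e ^+ 2 * x ^+ 2.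
  apply: (@le_trans _ _ ((h + e * x) ^+ 2)).
    by rewrite ler_sqr ?nnegrE ?addr_ge0// mulr_ge0// ltW.
  have := sqr_ge0 (h - e * x); lra.
have qK : - qform H u <= K * (2 * h ^+ 2 + 2 * e ^+ 2 * x ^+ 2).
  apply: le_trans (ler_norm _) _; rewrite normrN; apply: le_trans (HK u) _.
  by rewrite ler_pM2l.
have ex2 : e * x ^+ 2 <= e * dotp u u by rewrite ler_pM2l// norm_sqr_le_dotp.
have ex0 : 0 <= e * x ^+ 2 by rewrite mulr_ge0 ?sqr_ge0// ltW.
have eKx := ler_wpM2r ex0 eK.
have exh : e * x ^+ 2 <= 4 * K * h ^+ 2 by move: qv; rewrite q'E; lra.
have qh : - qform H' u <= 4 * K * h ^+ 2 by rewrite q'E; lra.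
have Ce0 : 0 <= 4 * C * e by rewrite !mulr_ge0// ltW.
have Cex := ler_wpM2l Ce0 exh.
have Ch := ler_wpM2r (sqr_ge0 h) eC.
have -> : (1 + c / (8 * K)) * qform H' u = qform H' u - c / (8 * K) * (- qform H' u).
  by ring.
have k0 : 0 <= c / (8 * K) by rewrite divr_ge0 ?mulr_ge0// ltW.
have := ler_wpM2l k0 qh.
have -> : c / (8 * K) * (4 * K * h ^+ 2) = c * h ^+ 2 / 2.
  by field; rewrite gt_eqF.
lra.
Qed.

End PerturbedQuadraticCycle.

(** * Sets of content zero *)

Section ContentNull.
Variables (R : realType) (n : nat).
Implicit Types (x y c : 'cV[R]_n.+1) (X Y : set 'cV[R]_n.+1).
Implicit Types (s : seq ('cV[R]_n.+1 * R)).

Local Notation N := (n.+1%:R : R).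

Definition cube_cover s X :=
  (forall p, p \in s -> 0 <= p.2) /\
  (forall x, X x -> exists2 p, p \in s & `|x - p.1| < p.2).

(** Jordan content zero, with cubes. Finite covers suffice for every set that is
    met before the final countable union, and cubes, unlike boxes, are carried to
    cubes of comparable size by the inverse of an expansive map. *)
Definition content_null X := forall e : R, 0 < e ->
  exists2 s, cube_cover s X & \sum_(p <- s) p.2 ^+ n.+1 <= e.

Lemma content_null0 : content_null set0.
Proof. by move=> e e0; exists [::]; rewrite ?big_nil ?ltW//; split. Qed.

Lemma content_nullU X Y : content_null X -> content_null Y -> content_null (X `|` Y).
Proof.
move=> X0 Y0 e e0; have e2 : 0 < e / 2 by rewrite divr_gt0.
have [s [sp sX] se] := X0 _ e2; have [t [tp tY] te] := Y0 _ e2.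
exists (s ++ t); last by rewrite big_cat /=; lra.
split=> [p|x [/sX|/tY] [p ps xp]]; first by rewrite mem_cat => /orP[/sp|/tp].
  by exists p; rewrite // mem_cat ps.
by exists p; rewrite // mem_cat ps orbT.
Qed.

Lemma content_null_bigcup_seq (I : eqType) (r : seq I) (X : I -> set 'cV[R]_n.+1) :
  (forall i, i \in r -> content_null (X i)) ->
  content_null (\bigcup_(i in [set` r]) X i).
Proof.
elim: r => [|i r IH] X0.
  rewrite (_ : bigcup _ _ = set0); first exact: content_null0.
  by apply/seteqP; split=> // x [].
rewrite (_ : bigcup _ _ = X i `|` \bigcup_(j in [set` r]) X j).
  apply: content_nullU; first by apply: X0; rewrite inE eqxx.
  by apply: IH => j jr; apply: X0; rewrite inE jr orbT.
apply/seteqP; split=> x /=.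
  by move=> [j /=]; rewrite inE => /orP[/eqP->|jr] Xj; [left|right; exists j].
by move=> [Xi|[j jr Xj]]; [exists i|exists j]; rewrite //= inE ?eqxx// jr orbT.
Qed.

(** The part of X that F sends into a ball of radius r has diameter at most
    2 L r, hence lies in the ball of radius 2 L r about any of its points. *)
Lemma content_null_expansive (F : 'cV[R]_n.+1 -> 'cV[R]_n.+1) (L : R) X Y : 0 < L ->
  (forall x y, X x -> X y -> `|x - y| <= L * `|F x - F y|) ->
  (forall x, X x -> Y (F x)) -> content_null Y -> content_null X.
Proof.
move=> L0 FL XY Y0 e e0.
have d0 : 0 < e / (2 * L) ^+ n.+1 by rewrite divr_gt0// exprn_gt0// mulr_gt0.
have [s [sp sY] se] := Y0 _ d0.
have /choice[f fP] : forall p : 'cV[R]_n.+1 * R, exists c,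
    forall x, X x -> `|F x - p.1| < p.2 -> `|x - c| < 2 * L * p.2.
  move=> p; have [[c Xc cp]|no] := pselect (exists2 c, X c & `|F c - p.1| < p.2).
    exists c => x Xx xp; apply: le_lt_trans (FL _ _ Xx Xc) _.
    rewrite [2 * L]mulrC -mulrA ltr_pM2l// mulr_natl mulr2n.
    have -> : F x - F c = (F x - p.1) - (F c - p.1) by rewrite opprB addrA subrK.
    by apply: le_lt_trans (ler_normB _ _) _; rewrite ltrD.
  by exists 0 => x Xx xp; exfalso; apply: no; exists x.
exists [seq (f p, 2 * L * p.2) | p <- s].
  split=> [_ /mapP[p ps ->]/=|x Xx]; first by rewrite !mulr_ge0 ?sp// ltW.
  have [p ps xp] := sY _ (XY _ Xx); exists (f p, 2 * L * p.2).
    by apply: map_f.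
  exact: fP.
rewrite big_map /=; under eq_bigr do rewrite exprMn.
by rewrite -mulr_sumr mulrC -ler_pdivlMr// exprn_gt0// mulr_gt0.
Qed.

Lemma grid_index (K : nat) (t : R) : 0 <= t <= K.+1%:R ->
  exists2 k : nat, (k < K.+1)%N & k%:R <= t <= k.+1%:R.
Proof.
elim: K => [|K IH] /andP[t0 tK]; first by exists 0%N; rewrite ?t0.
have [tK1|Kt] := leP t K.+1%:R; last by exists K.+1; rewrite // tK ltW.
have [|k kK kt] := IH; first by rewrite t0.
by exists k; rewrite // leqW.
Qed.

(** A grid of K^n cubes of radius 2 M / K, with K = K'.+1 in the proof, has total
    volume of order 1 / K. The grid is indexed by functions on the n coordinates
    other than i. *)
Lemma flat_content_null (i : 'I_n.+1) (M : R) :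
  content_null [set x : 'cV[R]_n.+1 | x i 0 = 0 /\ `|x| <= M].
Proof.
wlog M0 : M / 0 < M.
  move=> H; have := H (`|M| + 1); rewrite ltr_wpDl// => /(_ isT) H1 e e0.
  have [s [sp sX] se] := H1 e e0; exists s => //; split=> // x [xi xM].
  by apply: sX; split=> //; rewrite (le_trans xM)// (le_trans (ler_norm M))// lerDl.
move=> e e0; pose K := Num.Def.trunc ((2 * M) ^+ n.+1 / e).
have K0 : 0 < K.+1%:R :> R by rewrite ltr0n.
pose r : R := 2 * M / K.+1%:R.
have r0 : 0 < r by rewrite divr_gt0// mulr_gt0.
pose c (phi : {ffun 'I_n -> 'I_K.+1}) : 'cV[R]_n.+1 := \col_j
  if unlift i j is Some j' then - M + (phi j')%:R * r + r / 2 else 0.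
exists [seq (c phi, r) | phi : {ffun 'I_n -> 'I_K.+1}].
  split=> [_ /mapP[phi _ ->]|x [xi xM]]; first exact: ltW.
  have /choice[phi phiP] : forall j : 'I_n, exists k : 'I_K.+1,
      `|x (lift i j) 0 - (- M + k%:R * r + r / 2)| < r.
    move=> j; have := le_trans (entry_le_norm x (lift i j)) xM.
    set t := x _ _; rewrite ler_norml => /andP[tl tu].
    have [|k kK] := @grid_index K ((t + M) / r).
      rewrite divr_ge0 ?(ltW r0)//= ?ler_pdivrMr//; last by lra.
      by rewrite /r mulrC divfK ?gt_eqF//; lra.
    rewrite ler_pdivlMr// ler_pdivrMr// => /andP[kt tk].
    exists (Ordinal kK); rewrite ltr_norml /=.
    move: tk; rewrite -natr1 mulrDl mul1r => tk; apply/andP; split; lra.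
  exists (c (finfun phi), r); first by apply: map_f; rewrite mem_enum.
  apply/(sup_norm_lt _ r0) => j; rewrite 2![in X in `|X|]mxE [c _ _ _]mxE.
  by case: unliftP => [j' ->|->]; rewrite ?ffunE ?phiP// xi subrr normr0.
rewrite big_map big_enum /= sumr_const card_ffun !card_ord -mulr_natl natrX.
rewrite /r exprMn exprVn [K.+1%:R ^+ n.+1]exprS invfM.
have Kn : K.+1%:R ^+ n != 0 :> R by rewrite expf_neq0// gt_eqF.
have -> : K.+1%:R ^+ n * ((2 * M) ^+ n.+1 * (K.+1%:R^-1 * (K.+1%:R ^+ n)^-1)) =
  (2 * M) ^+ n.+1 / K.+1%:R by rewrite [(2 * M) ^+ _ * _]mulrA mulrCA divff// mulr1.
rewrite ler_pdivrMr// [leRHS]mulrC -ler_pdivrMr//.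
have q0 : 0 <= (2 * M) ^+ n.+1 / e by rewrite divr_ge0 ?exprn_ge0 ?mulr_ge0// ltW.
by apply/ltW; have /andP[] := trunc_itv q0.
Qed.

(** Project along w onto a coordinate hyperplane transverse to w. As
    differences of points of X avoid the cone around w, this projection is
    injective on X with Lipschitz inverse, so X is as small as a bounded part of
    the hyperplane. *)
Lemma avoids_cone_content_null (H : 'M[R]_n.+1) w (rho : R) X :
  qform H w < 0 -> (forall x, X x -> `|x| <= rho) ->
  (forall x y, X x -> X y -> 0 <= qform H (x - y)) -> content_null X.
Proof.
move=> qw Xrho Xq.
have [i wi] : exists i, w i 0 != 0.
  have w0 : w^T != 0.
    apply: contraTneq qw => /(congr1 trmx); rewrite trmxK trmx0 => ->.
    by rewrite /qform mulmx0 dotp_mx mulmx0 mxE ltxx.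
  by have [i] := rV0Pn _ w0; rewrite mxE => wi; exists i.
pose w' : 'cV[R]_n.+1 := (w i 0)^-1 *: w.
have w'i : w' i 0 = 1 by rewrite mxE mulVf.
have qw' : qform H w' < 0.
  rewrite /qform -scalemxAr dotpZl dotpZr mulrA pmulr_rlt0//.
  by rewrite -expr2 exprn_even_gt0//= invr_eq0.
move: w' w'i qw' => w' w'i qw'.
pose a := - qform H w'; have a0 : 0 < a by rewrite oppr_gt0.
have [M M0 HM] := entry_bound H.
pose B := N * (N * M); have B0 : 0 <= B by rewrite !mulr_ge0.
have HB x y : `|dotp x (H *m y)| <= B * (`|x| * `|y|).
  apply: le_trans (dotp_norm _ _) _; rewrite /B -mulrA ler_wpM2l//.
  by rewrite mulrCA ler_wpM2l// mulmx_norm.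
pose b := 2 * B * `|w'|; have b0 : 0 <= b by rewrite !mulr_ge0.
pose L := (b + B + a) / a.
have L1 : 1 <= L by rewrite ler_pdivlMr//; lra.
pose proj x : 'cV[R]_n.+1 := x - x i 0 *: w'.
have slope x y : X x -> X y -> `|x i 0 - y i 0| <= L * `|proj x - proj y|.
  move=> Xx Xy; set t : R := x i 0 - y i 0; set z : 'cV[R]_n.+1 := proj x - proj y.
  have xyE : x - y = t *: w' + z.
    by apply/matrixP => j k; rewrite /z /t /proj !mxE; ring.
  move: z xyE => z xyE; have := Xq x y Xx Xy; rewrite xyE /qform mulmxDr -scalemxAr.
  rewrite !(dotpDl, dotpDr, dotpZl, dotpZr) => q0.
  have z0 : 0 <= `|z| := normr_ge0 _. have t0 : 0 <= `|t| := normr_ge0 _.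
  have t2 : `|t| ^+ 2 = t ^+ 2 by rewrite real_normK ?num_real.
  have at2 : a * `|t| ^+ 2 <= b * (`|t| * `|z|) + B * `|z| ^+ 2.
    have h1 : t * dotp w' (H *m z) <= `|t| * (B * (`|w'| * `|z|)).
      by apply: le_trans (ler_norm _) _; rewrite normrM ler_wpM2l.
    have h2 : t * dotp z (H *m w') <= `|t| * (B * (`|z| * `|w'|)).
      by apply: le_trans (ler_norm _) _; rewrite normrM ler_wpM2l.
    have h3 : dotp z (H *m z) <= B * (`|z| * `|z|).
      exact: le_trans (ler_norm _) (HB _ _).
    by rewrite t2 /b /a /qform; lra.
  rewrite leNgt; apply/negP => Lt.
  have zt : `|z| <= `|t| by apply: le_trans (ltW Lt); rewrite ler_peMl.
  have tgt0 : 0 < `|t| by apply: le_lt_trans Lt; rewrite mulr_ge0// (le_trans ler01).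
  have Bz : B * `|z| ^+ 2 <= B * (`|t| * `|z|) by rewrite ler_wpM2l// expr2 ler_wpM2r.
  have : `|t| * (a * `|t|) <= `|t| * ((b + B) * `|z|) by lra.
  rewrite ler_pM2l// => atz.
  move: Lt; rewrite /L mulrAC ltr_pdivrMr//.
  have : 0 <= a * `|z| by rewrite mulr_ge0// ltW.
  lra.
have w'1 : 0 <= L * `|w'| by rewrite mulr_ge0// (le_trans ler01).
apply: (@content_null_expansive proj (L * `|w'| + 1) X
  [set x : 'cV[R]_n.+1 | x i 0 = 0 /\ `|x| <= rho + rho * `|w'|]).
- by rewrite ltr_wpDl.
- move=> x y Xx Xy; have -> : x - y = (x i 0 - y i 0) *: w' + (proj x - proj y).
    by apply/matrixP => j k; rewrite /proj !mxE; ring.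
  apply: le_trans (ler_normD _ _) _; rewrite mulrDl mul1r lerD// normrZ mulrAC.
  by rewrite ler_wpM2r// slope.
- move=> x Xx; split; first by rewrite /proj 3!mxE w'i mulr1 subrr.
  apply: le_trans (ler_normB _ _) _; rewrite lerD ?Xrho// normrZ ler_wpM2r//.
  by rewrite (le_trans (entry_le_norm _ _))// Xrho.
exact: flat_content_null.
Qed.

(** The k-th set is covered with total volume e / 2^(k+1). The cubes of all the
    covers are enumerated through the pairs (k, position in the k-th cover);
    codes of no pair and positions beyond the end of a list give a cube of
    radius 0, whose half-open box is empty. *)
Lemma bigcup_content_null_lebesgue_null (X : nat -> set 'cV[R]_n.+1) :
  (forall k, content_null (X k)) -> lebesgue_null (\bigcup_k X k).
Proof.
move=> X0; apply/le_anti/andP; split; last first.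
  apply/ereal_infP => _ [a [b [ab _ ->]]].
  apply: nneseries_ge0 => k _ _; rewrite lee_fin; apply: prodr_ge0 => i _.
  by rewrite subr_ge0.
apply/lee_addgt0Pr => e e0; rewrite add0e.
pose d k : R := e / 2 ^+ n.+1 / 2 ^+ k.+1.
have d0 k : 0 < d k by rewrite !divr_gt0// exprn_gt0.
have /choice[s sP] : forall k, exists s, cube_cover s (X k) /\
    \sum_(p <- s) p.2 ^+ n.+1 <= d k.
  by move=> k; have [s sX sd] := X0 k _ (d0 k); exists s.
pose dflt : 'cV[R]_n.+1 * R := (0, 0).
pose cube (q : nat * nat) := nth dflt (s q.1) q.2.
have cube0 q : 0 <= (cube q).2.
  rewrite /cube; have [qs|qs] := ltnP q.2 (size (s q.1)).
    exact: (sP q.1).1.1 _ (mem_nth _ _).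
  by rewrite nth_default.
pose nthcube m := if @pickle_inv (nat * nat)%type m is Some q then cube q else dflt.
have nthcube0 m : 0 <= (nthcube m).2.
  by rewrite /nthcube; case: pickle_inv.
pose lo m := (nthcube m).1 - const_mx (nthcube m).2.
pose hi m := (nthcube m).1 + const_mx (nthcube m).2.
have vol m : box_volume (lo m) (hi m) = 2 ^+ n.+1 * (nthcube m).2 ^+ n.+1.
  rewrite /box_volume -exprMn; set t := 2 * _.
  have -> : t ^+ n.+1 = \prod_(i < n.+1) t by rewrite prodr_const card_ord.
  by apply: eq_bigr => i _; rewrite /t !mxE; ring.
apply: (@le_trans _ _ (\sum_(0 <= m <oo) (box_volume (lo m) (hi m))%:E)%E).
  apply: ereal_inf_lbound; exists lo, hi; split=> // [m i|x [k _ Xkx]].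
    by rewrite !mxE lerD2l; have := nthcube0 m; lra.
  have [p ps xp] := (sP k).1.2 _ Xkx.
  exists (pickle (k, index p (s k))) => // i.
  rewrite /lo /hi /nthcube pickleK_inv /cube /= nth_index// !mxE.
  have p0 : 0 < p.2 by apply: le_lt_trans xp.
  have := (sup_norm_lt (x - p.1) p0).2 xp i; rewrite !mxE ltr_norml.
  by move=> /andP[? ?]; apply/andP; split; lra.
apply: lime_le.
  apply: is_cvg_nneseries => m _ _; rewrite vol lee_fin.
  by rewrite mulr_ge0 ?exprn_ge0.
near=> M; rewrite sumEFin lee_fin.
under eq_bigr do rewrite vol.
rewrite -mulr_sumr mulrC -ler_pdivlMr ?exprn_gt0//.
pose r (q : nat * nat) := (cube q).2 ^+ n.+1.
have r0 q : 0 <= r q by rewrite exprn_ge0.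
pose qs := pmap (@pickle_inv (nat * nat)%type) (iota 0 M).
have -> : \sum_(0 <= m < M) (nthcube m).2 ^+ n.+1 = \sum_(q <- qs) r q.
  rewrite /qs /index_iota subn0; elim: (iota 0 M) => [|m t IH]; first by rewrite !big_nil.
  rewrite big_cons IH /= /nthcube; case: pickle_inv => [q|] /=; first by rewrite big_cons.
  by rewrite expr0n add0r.
have [K Kqs] : exists K : nat, forall q, q \in qs -> (q.1 < K)%N && (q.2 < K)%N.
  elim: qs => [|q t [K KP]]; first by exists 0%N.
  exists (maxn K (maxn q.1 q.2).+1) => q'; rewrite inE => /orP[/eqP->|/KP/andP[h1 h2]].
    by rewrite !leq_max !ltnS leq_maxl leq_maxr !orbT.
  by rewrite !leq_max h1 h2.
have qs_uniq : uniq qs.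
  by rewrite (pmap_uniq (@pickle_invK (nat * nat)%type)) ?iota_uniq.
apply: (@le_trans _ _ (\sum_(q <- [seq (k, l) | k <- iota 0 K, l <- iota 0 K]) r q)).
  set T := [seq (k, l) | k <- iota 0 K, l <- iota 0 K]; have T_uniq : uniq T.
    by apply: allpairs_uniq; rewrite ?iota_uniq// => -[? ?] [? ?] _ _ [-> ->].
  have qsT : perm_eq [seq q <- T | q \in qs] qs.
    apply: uniq_perm; rewrite ?filter_uniq// => q; rewrite mem_filter.
    rewrite andb_idr// => /Kqs/andP[kK lK]; apply/allpairsP; exists q.
    by rewrite !mem_iota -surjective_pairing.
  by rewrite -[leLHS](perm_big _ qsT) big_filter [leRHS](bigID (mem qs))/= lerDl sumr_ge0.
rewrite big_allpairs.
apply: (@le_trans _ _ (\sum_(k <- iota 0 K) d k)).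
  apply: ler_sum => k _; apply: le_trans (sP k).2.
  have -> : iota 0 K = index_iota 0 K by rewrite /index_iota subn0.
  set z := size (s k).
  apply: (@le_trans _ _ (\sum_(0 <= l < z + K) r (k, l))).
    by rewrite (big_cat_nat (leq0n K) (leq_addl _ _))//= lerDl; apply: sumr_ge0.
  rewrite (big_cat_nat (leq0n z) (leq_addr _ _))//= [X in _ + X]big1_seq.
    by rewrite addr0 (big_nth dflt) /r /cube.
  move=> l /andP[_]; rewrite mem_index_iota => /andP[zl _].
  by rewrite /r /cube /= nth_default// expr0n.
suff -> : \sum_(k <- iota 0 K) d k = e / 2 ^+ n.+1 - e / 2 ^+ n.+1 / 2 ^+ K.
  by rewrite gerBl !divr_ge0// ltW.
have -> : iota 0 K = index_iota 0 K by rewrite /index_iota subn0.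
elim: K {Kqs} => [|K IH]; first by rewrite big_geq// expr0 divr1 subrr.
rewrite big_nat_recr//= IH /d; set D := e / 2 ^+ n.+1; rewrite exprS; field.
by rewrite expf_neq0.
Unshelve. all: by end_near.
Qed.

End ContentNull.

(** * Local stable sets of saddles and the convergence theorem *)

Section LocalStableSets.
Variables (R : realType) (n : nat) (A : 'M[R]_n.+1) (rho gamma : R).
Hypothesis A_sym : A^T = A.
Hypothesis rho_gt0 : 0 < rho.
Hypothesis col_le : forall j, dotp (col j A) (col j A) <= rho ^+ 4.
Hypothesis gamma_gt0 : 0 < gamma.
Hypothesis gamma_le : gamma * (4 * (n.+1%:R + 4) * rho ^+ 2) <= 1.
Implicit Types (x y z : 'cV[R]_n.+1).

Local Notation N := (n.+1%:R : R).
Local Notation grad := (objective_grad A).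
Local Notation orbit := (cd_cyc_grad A gamma).

Lemma hessian_sym z : (hessian A z)^T = hessian A z.
Proof.
rewrite /hessian !linearD !linearZ /= A_sym tr_scalar_mx trmx_mul trmxK.
by [].
Qed.

(** The slack 4 rho^2 comes from the N + 4, instead of N + 3, in the stepsize;
    it makes room for the shift of the Hessian in [negative_cone_expansion]. *)
Lemma hessian_diag_le z j : `|z| <= rho ->
  gamma * (hessian A z j j + 4 * rho ^+ 2) <= 1.
Proof.
move=> zr; apply: le_trans gamma_le; rewrite ler_pM2l//.
have -> : hessian A z j j = - 4 * A j j + 4 * dotp z z + 8 * z j 0 ^+ 2.
  by rewrite !mxE eqxx mulr1n big_ord1 !mxE; ring.
have := entry_le_sqr rho_gt0 col_le j j; rewrite ler_norml => /andP[Aj _].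
have := dotp_le_rho zr => zz.
have : z j 0 ^+ 2 <= rho ^+ 2.
  rewrite -[leLHS]real_normK ?num_real// ler_sqr ?nnegrE ?(ltW rho_gt0)//.
  exact: le_trans (entry_le_norm _ _) zr.
lra.
Qed.

(** Taylor's formula with an explicit modulus, from the cubic part of the
    gradient: each of the three remaining terms has a factor x - z or y - z. *)
Lemma grad_hessian_approx x y z (r : R) j : `|x| <= rho -> `|y| <= rho -> `|z| <= rho ->
  `|x - z| <= r -> `|y - z| <= r ->
  `|grad x j - grad y j - (hessian A z *m (x - y)) j 0| <= 24 * N * rho * r * `|x - y|.
Proof.
move=> xr yr zr xz yz; rewrite grad_sub hessian_mulmx; set v : 'cV[R]_n.+1 := x - y.
have entE (a b c : R) (p q s : 'cV[R]_n.+1) :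
    (a *: p + b *: q + c *: s) j 0 = a * p j 0 + b * q j 0 + c * s j 0.
  by rewrite !mxE.
have subE : (y - z) j 0 = y j 0 - z j 0 by rewrite !mxE.
have -> : - 4 * (A *m v) j 0 + 4 * (dotp x x * v j 0 + dotp (x + y) v * y j 0) -
    ((- 4) *: (A *m v) + (4 * dotp z z) *: v + (8 * dotp z v) *: z) j 0 =
    4 * (dotp (x + z) (x - z) * v j 0 + dotp ((x - z) + (y - z)) v * y j 0 +
    2 * dotp z v * (y - z) j 0).
  have -> : dotp (x + z) (x - z) = dotp x x - dotp z z.
    by rewrite -(scaleN1r z) !(dotpDl, dotpDr, dotpZl, dotpZr) (dotpC z x); ring.
  have -> : dotp (x - z + (y - z)) v = dotp (x + y) v - 2 * dotp z v.
    by rewrite -(scaleN1r z) !(dotpDl, dotpZl); ring.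
  by rewrite entE subE; ring.
have vj := entry_le_norm v j.
have v0 := normr_ge0 v.
have h1 : `|dotp (x + z) (x - z) * v j 0| <= N * ((rho + rho) * r) * `|v|.
  rewrite normrM ler_pM//; apply: le_trans (dotp_norm _ _) _.
  rewrite ler_wpM2l// ler_pM//.
  by apply: le_trans (ler_normD _ _) _; rewrite lerD.
have h2 : `|dotp (x - z + (y - z)) v * y j 0| <= N * ((r + r) * `|v|) * rho.
  rewrite normrM ler_pM// ?(le_trans (entry_le_norm _ _) yr)//.
  apply: le_trans (dotp_norm _ _) _; rewrite ler_wpM2l// ler_wpM2r//.
  by apply: le_trans (ler_normD _ _) _; rewrite lerD.
have h3 : `|2 * dotp z v * (y - z) j 0| <= 2 * (N * (rho * `|v|)) * r.
  rewrite normrM ler_pM// ?(le_trans (entry_le_norm _ _) yz)//.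
  rewrite normrM normr_nat ler_wpM2l//; apply: le_trans (dotp_norm _ _) _.
  by rewrite ler_wpM2l// ler_wpM2r.
rewrite normrM normr_nat.
set a := dotp _ _ * v j 0 in h1 *; set b := dotp _ _ * y j 0 in h2 *.
set c := _ * (y - z) j 0 in h3 *.
have := ler_normD (a + b) c; have := ler_normD a b; lra.
Qed.

Definition local_stable_set z (r : R) : set 'cV[R]_n.+1 :=
  [set x | `|x| < rho /\ forall m, `|orbit x m - z| < r].

Lemma orbit_difference_perturbed_cycle x y z (r delta : R) k :
  `|z| <= rho -> 24 * N * rho * r <= delta ->
  local_stable_set z r x -> local_stable_set z r y ->
  perturbed_cycle (hessian A z) gamma delta
    (fun m => orbit x (k * n.+1 + m) - orbit y (k * n.+1 + m)).
Proof.
move=> zr rd [xr xz] [yr yz].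
pose l m := (k * n.+1 + m)%N; pose j m := inord m : 'I_n.+1.
exists (fun m => grad (orbit x (l m)) (j m) - grad (orbit y (l m)) (j m) -
   (hessian A z *m (orbit x (l m) - orbit y (l m))) (j m) 0) => m mn.
  apply: le_trans (@grad_hessian_approx _ _ _ r _ _ _ zr _ _) _.
  - exact/ltW/orbit_stays.
  - exact/ltW/orbit_stays.
  - exact/ltW/xz.
  - exact/ltW/yz.
  by rewrite ler_wpM2r.
rewrite addnS /= modnMDl modn_small// -/(l m) -/(j m) !cd_stepE.
set h := (hessian A z *m _) _ _; set a := grad (orbit x _) _.
set b := grad (orbit y _) _; have -> : h + (a - b - h) = a - b by ring.
by apply/matrixP => i0 i1; rewrite !mxE; ring.
Qed.

(** A pair of points of the local stable set whose difference has a negative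
    form would see this form grow geometrically along the cycles, although the
    two orbits remain within 2 r of each other. *)
Lemma local_stable_set_content_null z w : `|z| <= rho ->
  dotp w (hessian A z *m w) < 0 ->
  exists2 r, 0 < r & content_null (local_stable_set z r).
Proof.
move=> zr qw.
have r2 : 0 < 4 * rho ^+ 2 by rewrite mulr_gt0// exprn_gt0.
have [H [delta [eta [d0 eta0 Hw expand]]]] := negative_cone_expansion gamma_gt0 r2
  (hessian_sym z) (fun j => hessian_diag_le j zr) qw.
have c0 : 0 < 24 * N * rho by rewrite !mulr_gt0.
pose r := delta / (24 * N * rho); exists r; first by rewrite divr_gt0.
have rd : 24 * N * rho * r <= delta by rewrite /r mulrC divfK// gt_eqF.
apply: (avoids_cone_content_null Hw (rho := rho)) => [x [/ltW]//|x y Sx Sy].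
pose V k := orbit x (k * n.+1) - orbit y (k * n.+1).
have V0 : V 0%N = x - y by rewrite /V mul0n.
rewrite -V0 leNgt; apply/negP => q0.
have Vq k : qform H (V k) < 0 /\ qform H (V k) <= (1 + eta) ^+ k * qform H (V 0%N).
  elim: k => [|k [IH0 IH]]; first by rewrite expr0 mul1r.
  have := expand _ (orbit_difference_perturbed_cycle k zr rd Sx Sy).
  rewrite addn0 -/(V k) -mulSnr -/(V k.+1) => /(_ IH0) Vk1.
  have e1 : 0 < 1 + eta by lra.
  split; first by apply: le_lt_trans Vk1 _; rewrite pmulr_rlt0.
  by apply: le_trans Vk1 _; rewrite exprS -mulrA ler_pM2l.
have [M M0 HM] := entry_bound H.
have Vr k : `|V k| <= r + r.
  have -> : V k = (orbit x (k * n.+1) - z) - (orbit y (k * n.+1) - z).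
    by rewrite opprB addrA subrK.
  by apply: le_trans (ler_normB _ _) _; rewrite lerD// ltW ?Sx.2 ?Sy.2.
pose B := N * ((r + r) * (N * M * (r + r))).
have qB k : - B <= qform H (V k).
  rewrite lerNl; apply: le_trans (ler_norm _) _; rewrite normrN.
  apply: le_trans (dotp_norm _ _) _; rewrite ler_wpM2l// ler_pM//.
  by apply: le_trans (mulmx_norm _ HM) _; rewrite ler_wpM2l ?mulr_ge0.
have bern k : k%:R * eta <= (1 + eta) ^+ k.
  elim: k => [|k IH]; first by rewrite mul0r expr0.
  have e1 : 1 <= (1 + eta) ^+ k by rewrite exprn_ege1// lerDl ltW.
  have := ler_wpM2r (ltW eta0) e1; rewrite exprSr -natr1; lra.
have a0 : 0 < eta * - qform H (V 0%N) by rewrite mulr_gt0// oppr_gt0.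
have B0 : 0 <= B / (eta * - qform H (V 0%N)).
  rewrite divr_ge0 ?(ltW a0)//.
  have r0 : 0 <= r + r by rewrite addr_ge0// divr_ge0// ltW.
  by rewrite /B !mulr_ge0.
have /andP[_] := trunc_itv B0; set k := (Num.Def.trunc _).+1.
rewrite ltr_pdivrMr// => Bk.
have nq : 0 <= - qform H (V 0%N) by rewrite oppr_ge0 ltW.
have := ler_wpM2r nq (bern k); have := qB k; have := (Vq k).2; lra.
Qed.

End LocalStableSets.

Theorem theorem3p1 (R : realType) (n : nat) (A : 'M[R]_n.+1)
    (lambda : 'I_n.+1 -> R) (rho gamma : R)
    (A_sym : A^T = A)
    (A_eigenvalues : char_poly A = \prod_(i < n.+1) ('X - (lambda i)%:P))
    (lambda_sorted : forall i j : 'I_n.+1, (i <= j)%N -> lambda j <= lambda i)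
    (lambda_gap : forall i : 'I_n.+1, i != ord0 -> lambda i < lambda ord0)
    (lambda1_gt0 : 0 < lambda ord0)
    (pos_eigenvalues_distinct :
      forall i j : 'I_n.+1, 0 < lambda i -> lambda i = lambda j -> i = j)
    (rho_ge : Num.sqrt (\big[Num.max/0]_(j < n.+1) euclidean_norm (col j A))
              <= rho)
    (gamma_gt0 : 0 < gamma)
    (gamma_le : gamma <= 1 / (4 * (n.+1%:R + 4) * rho ^+ 2)) :
  exists N : set 'cV[R]_n.+1, lebesgue_null N /\
    forall x0 : 'cV[R]_n.+1, `|x0| < rho -> ~ N x0 ->
      exists xstar : 'cV[R]_n.+1,
        global_minimizer (objective A) xstar /\
        cd_cyc_grad A gamma x0 l @[l --> \oo] --> xstar.
Proof.
have rho_gt0 : 0 < rho.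
  rewrite lt_neqAle (le_trans (sqrtr_ge0 _) rho_ge) andbT eq_sym.
  apply: contraTneq gamma_le => ->.
  by rewrite expr0n mulr0 invr0 mulr0 -ltNge.
have k0 : 0 < 4 * (n.+1%:R + 4) * rho ^+ 2.
  by apply: mulr_gt0; [apply: mulr_gt0 => //; rewrite ltr_wpDl|exact: exprn_gt0].
have step_le : gamma * (4 * (n.+1%:R + 4) * rho ^+ 2) <= 1.
  by move: gamma_le; rewrite ler_pdivlMr.
have col_le j : dotp (col j A) (col j A) <= rho ^+ 4.
  set M := \big[_/_]_(j < _) _ in rho_ge.
  have cM : euclidean_norm (col j A) <= M.
    exact: (le_bigmax _ (fun j => euclidean_norm (col j A))).
  have c0 : 0 <= euclidean_norm (col j A) by exact: sqrtr_ge0.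
  have Mr : M <= rho ^+ 2.
    rewrite -[leLHS]sqr_sqrtr ?(le_trans c0)//.
    by rewrite ler_sqr ?nnegrE ?sqrtr_ge0 ?(ltW rho_gt0).
  rewrite -euclidean_norm_sqr -[4%N]/(2 * 2)%N exprM.
  by rewrite ler_sqr ?nnegrE ?exprn_ge0 ?(ltW rho_gt0) ?(le_trans cM).
have lambda_le i : lambda i <= lambda ord0 by exact: lambda_sorted.
have [s sP] := critical_finite A_sym A_eigenvalues pos_eigenvalues_distinct.
pose saddle z := [/\ critical A z, ~ global_minimizer (objective A) z & `|z| <= rho].
have /choice[r rP] : forall z, exists r, 0 < r /\
    (saddle z -> content_null (local_stable_set A rho gamma z r)).
  move=> z; have [[cz nmin zr]|nz] := pselect (saddle z); last by exists 1.
  have [w qw] := nonminimal_critical_strict_saddle A_sym A_eigenvalues lambda_le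
    lambda1_gt0 pos_eigenvalues_distinct cz nmin.
  by have [r r0 S0] := local_stable_set_content_null A_sym rho_gt0 col_le gamma_gt0
    step_le zr qw; exists r.
(* The points that are in the local stable set of the saddle z after k cycles.
   Time is counted in whole cycles because the schedule restarts only there. *)
pose E k z := [set x : 'cV[R]_n.+1 | [/\ saddle z, `|x| < rho &
  local_stable_set A rho gamma z (r z) (cd_cyc_grad A gamma x (k * n.+1))]].
exists (\bigcup_k \bigcup_(z in [set` s]) E k z); split.
  apply: bigcup_content_null_lebesgue_null => k.
  apply: content_null_bigcup_seq => z _.
  have [sz|nsz] := pselect (saddle z); last first.
    rewrite (_ : E k z = set0); first exact: content_null0.
    by apply/seteqP; split=> // x [].
  apply: (@content_null_expansive _ _ (fun x => cd_cyc_grad A gamma x (k * n.+1))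
    ((5 * (n.+1%:R + 4)) ^+ (k * n.+1)) _ (local_stable_set A rho gamma z (r z))).
  - by rewrite exprn_gt0// mulr_gt0// ltr_wpDl.
  - move=> x y [_ xr _] [_ yr _].
    exact: (orbit_expansive A_sym rho_gt0).
  - by move=> x [].
  exact: (rP z).2.
move=> x0 x0r x0N.
have [z [zs zlim _]] := orbit_cvg_critical A_sym rho_gt0 col_le gamma_gt0 step_le
  (fun z => (sP z).2) x0r.
exists z; split=> //; apply: contrapT => nmin; apply: x0N.
have sz : saddle z.
  split=> //; first exact/sP.
  apply: (cvgr_to_le (cvg_norm zlim)); near=> l.
  by apply/ltW/orbit_stays.
have /cvgrPdist_lt/(_ _ (rP z).1) [k _ kP] := zlim.
exists k => //; exists z => //; split=> //; split=> [|m]; first exact: orbit_stays.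
rewrite -orbit_shift distrC; apply: kP => /=.
by rewrite (leq_trans _ (leq_addr _ _))// leq_pmulr.
Unshelve. all: by end_near.
Qed.
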